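(* Let $q$ be a power of an odd prime, let $d\ge 2$ and $k\in\{1,2,\dots,d\}$ be integers. There is a constant $C>0$, independent of $q$, such that for every subset $E\subset\mathbb{F}_q^d$ with $$|E|\ge C\, q^{\max\{(d+1)/2,\ d-k\}}$$ one has $D_k(E)=\mathbb{F}_q$.
   Context: $\mathbb{F}_q$ denotes the finite field with $q$ elements. For $x=(x_1,\dots,x_d)\in\mathbb{F}_q^d$ put $\|x\|=x_1^2+\cdots+x_d^2$, and let $\mathcal{Z}(x)$ denote the number of coordinates of $x$ equal to $0$. For fixed $k\in\{1,\dots,d\}$ the $k$-norm is defined by $\|x\|_k=\|x\|$ if $0\le \mathcal{Z}(x)\le k-1$, and $\|x\|_k=0$ otherwise. For $E\subset\mathbb{F}_q^d$, the $k$-distance set is $D_k(E)=\{\|x-y\|_k : x,y\in E\}$. *)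

(* Defs.v *)
From HB Require Import structures.
From mathcomp Require Import all_boot all_order all_algebra.
From mathcomp Require Import reals exp.

Set Implicit Arguments.
Unset Strict Implicit.
Unset Printing Implicit Defensive.

Import GRing.Theory.
Local Open Scope ring_scope.

(* The sum of the squares of the coordinates, without square root. *)
Definition sqnorm (F : finFieldType) (d : nat) (x : 'rV[F]_d) : F :=
  \sum_(i < d) x 0 i ^+ 2.

Definition nzeros (F : finFieldType) (d : nat) (x : 'rV[F]_d) : nat :=
  #|[set i : 'I_d | x 0 i == 0]|.

(* Only used for 1 <= k <= d, where the subtraction does not truncate. *)
Definition knorm (F : finFieldType) (d k : nat) (x : 'rV[F]_d) : F :=
  if (nzeros x <= k - 1)%N then sqnorm x else 0.

Definition kdist (F : finFieldType) (d k : nat) (E : {set 'rV[F]_d}) : {set F} :=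
  [set knorm k (x - y) | x in E, y in E].

(* Main.v *)
Require Import Defs.
From HB Require Import structures.
From mathcomp Require Import all_boot all_order all_algebra all_field fingroup cyclic.
From mathcomp Require Import reals exp.
From mathcomp Require Import zify ring.

(* Call a pair (x, y) in E^2 with ||x - y|| = t <> 0 bad if x - y has at least k
   zero coordinates. Splitting by the zero set, there are at most
   2^(d+1) q^(d-k-1) |E| bad pairs, whereas Iosevich and Rudnev's theorem gives
   |E|^2/q + O(q^((d-1)/2) |E|) pairs at distance t in all. The error term is a
   Fourier coefficient of the sphere, that is, a Salie sum for odd d (evaluated
   explicitly) and a Kloosterman sum for even d.

   The bound K^2 <= 4 q for Kloosterman sums K goes as follows. If F' is the
   quadratic extension of a field F of size q, then K_{F'} = 2 q - K_F^2, since any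
   pair (t, n) is the (trace, norm) of some elements of F' and the (sum, product) of
   some pairs over F, exactly two in total. If K^2 > 4 q then, along a tower of
   quadratic extensions F_j with q_j elements, -K_j / sqrt q_j tends to infinity.
   The sum of -K_j over all characters s.psi (s <> 0 in F) bounds each -K_j from above,
   since all its terms are at least -2 sqrt q_j; and it is O(sqrt q_j) because the
   Artin-Schreier curves y^q - y = a x + b / x - c have at most q_j + O(sqrt q_j)
   points. This last estimate is Bombieri's form of Stepanov's method: a function
   vanishing at all rational points is found among the combinations of the
   (x^k y^j) (x^i y^l)^r with r = sqrt q_j by linear algebra, using that y^r - y is a
   rational function of x. *)

Set Implicit Arguments.
Unset Strict Implicit.
Unset Printing Implicit Defensive.
Import Order.TTheory GRing.Theory Num.Theory.
Local Open Scope ring_scope.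

(** * Fibers, polynomials and finite fields *)

Lemma sum_card_fibers (T U : finType) (f : T -> U) :
  (\sum_u #|[set x | f x == u]| = #|T|)%N.
Proof.
rewrite -sum1_card (partition_big f xpredT) //=.
by apply: eq_bigr => u _; rewrite -sum1dep_card.
Qed.

Lemma sum_fibers (T U : finType) (R : nzRingType) (P : pred U) (f : T -> U)
    (G : U -> R) :
  \sum_(x | P (f x)) G (f x) = \sum_(u | P u) #|[set x | f x == u]|%:R * G u.
Proof.
rewrite (partition_big f P) //=; apply: eq_bigr => u Pu.
rewrite (eq_bigr (fun _ => G u)) => [|x /andP[_ /eqP->]//].
rewrite sumr_const mulr_natl; congr (_ *+ _); rewrite -sum1dep_card -sum1_card.
by apply: eq_bigl => x; rewrite unfold_in /=; case: eqP => [->|]; rewrite ?Pu ?andbF.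
Qed.

Lemma leq_card_fibers (T U : finType) (A : {set T}) (B : {set U}) (f : T -> U) k :
    (forall x, x \in A -> f x \in B) ->
    (forall u, u \in B -> (#|[set x in A | f x == u]| <= k)%N) ->
  (#|A| <= k * #|B|)%N.
Proof.
move=> fAB fib_k; rewrite -sum1_card (partition_big f (mem B)) //=.
rewrite mulnC -sum_nat_const; apply: leq_sum => u uB.
by apply: leq_trans (fib_k u uB); rewrite -sum1dep_card.
Qed.

Lemma card_fibersD_eq (T1 T2 U : finType) (f1 : T1 -> U) (f2 : T2 -> U) k :
    (forall u, (#|[set x | f1 x == u]| + #|[set x | f2 x == u]| <= k)%N) ->
    (#|T1| + #|T2| = #|U| * k)%N ->
  forall u, (#|[set x | f1 x == u]| + #|[set x | f2 x == u]|)%N = k.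
Proof.
move=> fib_k card_k u; pose N u := (#|[set x | f1 x == u]| + #|[set x | f2 x == u]|)%N.
have /leqif_sum[_] : forall v, xpredT v -> (N v <= k ?= iff (N v == k))%N.
  by move=> v _; split; first exact: fib_k.
rewrite big_split /= !sum_card_fibers sum_nat_const card_k eqxx.
by move/esym/forallP/(_ u)/eqP.
Qed.

Lemma add_muln_inj (r a a' b b' : nat) : (a < r)%N -> (a' < r)%N ->
  (a + r * b = a' + r * b')%N -> a = a' /\ b = b'.
Proof.
have modE c d : (c < r)%N -> ((c + r * d) %% r = c)%N.
  by move=> cr; rewrite addnC mulnC modnMDl modn_small.
move=> ar ar' eq_ab; have aa' : a = a' by rewrite -(modE a b) // eq_ab modE.
split=> //; move: eq_ab; rewrite aa' => /addnI/eqP.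
by rewrite eqn_pmul2l => [/eqP//|]; apply: leq_ltn_trans ar.
Qed.

Lemma homogeneous_system_nontrivial (K : fieldType) (T U : finType)
    (M : T -> U -> K) : (#|U| < #|T|)%N ->
  exists c : T -> K, (exists t, c t != 0) /\ forall u, \sum_t c t * M t u = 0.
Proof.
move=> ltUT.
pose A : 'M[K]_(#|T|, #|U|) := \matrix_(i, j) M (enum_val i) (enum_val j).
have : ~~ row_free A.
  by rewrite /row_free neq_ltn (leq_ltn_trans (rank_leq_col A) ltUT).
rewrite -kermx_eq0 => /rowV0Pn [v /sub_kermxP vA /rV0Pn [i vi]].
exists (fun t => v 0 (enum_rank t)); split.
  by exists (enum_val i); rewrite enum_valK.
move=> u; have /matrixP/(_ 0 (enum_rank u)) := vA.
rewrite !mxE (reindex (@enum_rank T)) /=; last first.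
  by apply: onW_bij; exists enum_val; [exact: enum_rankK | exact: enum_valK].
by move=> vAu; rewrite -[RHS]vAu; apply: eq_bigr => t _; rewrite mxE !enum_rankK.
Qed.

Lemma sum_distinct_degrees_neq0 (K : fieldType) (T : finType) (c : T -> K)
    (P : T -> {poly K}) (deg : T -> nat) :
    injective deg -> (forall t, size (P t) = (deg t).+1) -> (exists t, c t != 0) ->
  \sum_t c t *: P t != 0.
Proof.
move=> deg_inj sizeP [t0 ct0].
case: (@arg_maxnP _ t0 (fun t => c t != 0) deg ct0) => t ct deg_max.
apply: contraNneq ct => sum0.
have /eqP : (\sum_i c i *: P i)`_(deg t) = 0 by rewrite sum0 coef0.
rewrite coef_sum (bigD1 t) //= big1 ?addr0 => [|i i_neq_t].
  rewrite coefZ mulf_eq0 => /orP[// | ].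
  rewrite -[deg t]/((deg t).+1.-1) -sizeP -lead_coefE lead_coef_eq0.
  by rewrite -size_poly_eq0 sizeP.
rewrite coefZ; have [-> | ci] := eqVneq (c i) 0; first by rewrite mul0r.
rewrite nth_default ?mulr0 // sizeP ltn_neqAle [X in _ && X]deg_max // andbT.
by apply: contra i_neq_t => /eqP/deg_inj->.
Qed.

Lemma card_roots_lt_size (K : finFieldType) (p : {poly K}) (Z : {set K}) : p != 0 ->
  (forall x, x \in Z -> root p x) -> (#|Z| < size p)%N.
Proof.
move=> p0 Zp; rewrite cardE; apply: max_poly_roots => //; last exact: enum_uniq.
by apply/allP => x; rewrite mem_enum => /Zp.
Qed.

Lemma size_quadratic (R : nzRingType) (a b c : R) : a != 0 ->
  size (a *: 'X^2 + b *: 'X + c%:P) = 3.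
Proof.
move=> a0; have -> : a *: 'X^2 + b *: 'X + c%:P = Poly [:: c; b; a].
  by rewrite /= !cons_poly_def mul0r add0r mulrDl -!mul_polyC -mulrA expr2.
by rewrite (@PolyK _ 0).
Qed.

Lemma card_quadratic_roots_leq2 (K : finFieldType) (a b c : K) : a != 0 ->
  (#|[set x | (a * x ^+ 2 + b * x + c == 0)%R]| <= 2)%N.
Proof.
move=> a0; have sz := size_quadratic b c a0; rewrite -ltnS -[X in (_ < X)%N]sz.
apply: card_roots_lt_size; first by rewrite -size_poly_eq0 sz.
by move=> x; rewrite inE rootE !hornerE.
Qed.

Lemma pchar_nat_card (K : finFieldType) : [pchar K].-nat #|K|.
Proof.
have [p pr_p pK] := finPcharP K.
by rewrite (card_pprimeChar pK) pnatX pnatE // pK.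
Qed.

Lemma expr_sum_pchar (K : comNzRingType) n (I : Type) (s : seq I) (P : pred I)
    (u : I -> K) : [pchar K].-nat n ->
  (\sum_(i <- s | P i) u i) ^+ n = \sum_(i <- s | P i) u i ^+ n.
Proof.
move=> pn; apply: (big_morph (fun x => x ^+ n)) => [x y|].
  exact: exprDn_pchar.
by rewrite expr0n; case/andP: pn => /prednK<-.
Qed.

Lemma odd_card_gt2 (F : finFieldType) : odd #|F| -> (2 < #|F|)%N.
Proof. by have := finNzRing_gt1 F; case: #|F| => [|[|[]]]. Qed.

Lemma natr2_neq0_odd_card (F : finFieldType) : odd #|F| -> 2 != 0 :> F.
Proof.
rewrite odd_2'nat => odd_nat; apply/eqP => F20.
have two_pF : 2 \in [pchar F] by rewrite inE /= F20 eqxx.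
have := pchar_nat_card F; rewrite (eq_pnat _ (pcharf_eq two_pF)) => /pnat_1/(_ odd_nat).
by have := finNzRing_gt1 F; case: #|F| => [|[]].
Qed.

Lemma natr4_neq0 (F : fieldType) : 2 != 0 :> F -> 4 != 0 :> F.
Proof. by move=> F2; rewrite (natrM F 2 2) mulf_neq0. Qed.

Lemma nonsquare_exists (K : finFieldType) : 2 != 0 :> K ->
  exists e : K, forall x, x ^+ 2 != e.
Proof.
move=> K2; pose S := [set x ^+ 2 | x : K].
have [e eS | all_squares] := pickP [pred e | e \notin S].
  by exists e => x; apply: contraNneq eS => <-; apply: imset_f.
have /imset_injP sqr_inj : #|S| == #|[pred x : K | true]|.
  by apply/eqP/eq_card => e; have /negbFE := all_squares e; rewrite !inE.
have /eqP := sqr_inj 1 (- 1) isT isT (esym (sqrrN 1)).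
by rewrite -subr_eq0 opprK -mulr2n (negPf K2).
Qed.

Lemma quadratic_extension_exists (K : finFieldType) : 2 != 0 :> K ->
  exists (L : finFieldType) (iota : {rmorphism K -> L}), #|L| = (#|K| ^ 2)%N.
Proof.
move=> /nonsquare_exists[e e_nonsquare].
have sz : size ('X^2 - e%:P : {poly K}) = 3 by rewrite size_XnsubC.
have irr : irreducible_poly ('X^2 - e%:P : {poly K}).
  apply: cubic_irreducible; first by rewrite sz.
  by move=> x; rewrite rootE !hornerE ?hornerXn subr_eq0.
have [L0 dimL _] := irredp_FAdjoin irr.
pose L := FinFieldExtType L0.
have iota : {rmorphism K -> L} := (in_alg L0 : {rmorphism K -> L0}).
exists L, iota.
have := card_vspacef (Vector.class (finvect_type L0 : vectType K)).
by rewrite card_vspace => <-; move: dimL; rewrite sz => ->.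
Qed.

(** * Stepanov's method *)

Section SizeY.

Variable R : nzRingType.
Implicit Types (p : {poly R}) (u v : {poly {poly R}}).

Lemma sizeY_leq u n : (forall i, (size (u`_i)%R <= n)%N) -> (sizeY u <= n)%N.
Proof. by move=> le_n; apply/bigmax_leqP. Qed.

Lemma sizeYD u v : (sizeY (u + v) <= maxn (sizeY u) (sizeY v))%N.
Proof. by rewrite !sizeYE rmorphD size_polyD. Qed.

Lemma sizeY_sum (I : finType) (u : I -> {poly {poly R}}) :
  (sizeY (\sum_i u i) <= \max_i sizeY (u i))%N.
Proof.
rewrite sizeYE rmorph_sum (leq_trans (size_sum _ _ _)) //.
by apply/bigmax_leqP => i _; rewrite -sizeYE (leq_bigmax (F := fun i => sizeY (u i))).
Qed.

Lemma sizeYM u v : (sizeY (u * v) <= (sizeY u + sizeY v).-1)%N.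
Proof. by rewrite !sizeYE rmorphM size_polyMleq. Qed.

Lemma sizeY_exp u n : (sizeY (u ^+ n) <= ((sizeY u).-1 * n).+1)%N.
Proof. by rewrite !sizeYE rmorphXn size_poly_exp_leq. Qed.

Lemma sizeY_polyC p : sizeY p%:P = size p.
Proof. by rewrite sizeYE swapXY_polyC size_map_polyC. Qed.

Lemma sizeYZ p u : (sizeY (p *: u) <= (size p + sizeY u).-1)%N.
Proof. by rewrite -mul_polyC -(sizeY_polyC p) sizeYM. Qed.

Lemma sizeY_polyXn n : sizeY ('X^n : {poly {poly R}}) = 1.
Proof.
by rewrite sizeYE rmorphXn /= swapXY_X -polyC_exp size_polyC monic_neq0 ?monicXn.
Qed.

End SizeY.

Section Reduction.

Variables (L : fieldType) (q : nat) (g : {poly L}).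
Implicit Types (p : {poly L}) (u v : {poly {poly L}}).

(* The outer variable is [y], the inner one is [x]: modulo the relation
   [x * y^q = x * y + g(x)], [reduce u] equals [x * u]. *)
Definition reduce u : {poly {poly L}} :=
  'X *: take_poly q u + ('X *: 'X + g%:P) * drop_poly q u.

Fact reduce_is_linear : linear reduce.
Proof.
move=> p u v; rewrite /reduce take_polyD drop_polyD take_polyZ drop_polyZ.
rewrite mulrDr -scalerAr !scalerDr addrACA; congr (_ + _ + _).
by rewrite !scalerA mulrC.
Qed.

HB.instance Definition _ :=
  GRing.isLinear.Build {poly L} {poly {poly L}} {poly {poly L}} _ reduce
    reduce_is_linear.

Lemma horner2_reduce x y u : x * y ^+ q = x * y + g.[x] ->
  (reduce u).[y, x] = x * u.[y, x].
Proof.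
move=> xy; rewrite /reduce -{3}(poly_take_drop q u) !hornerE.
rewrite mulrDr mulrCA -xy; congr (_ + _); rewrite ?horner_exp ?hornerE /=; ring.
Qed.

Lemma reduceXn_small b : (b < q)%N -> reduce 'X^b = 'X *: 'X^b.
Proof.
move=> bq; rewrite /reduce take_poly_id ?drop_poly_eq0 ?size_polyXn //.
by rewrite mulr0 addr0.
Qed.

Lemma reduceXn_large b : (q <= b)%N ->
  reduce 'X^b = 'X *: 'X^((b - q).+1) + g *: 'X^(b - q).
Proof.
move=> qb; rewrite /reduce -{1 2}(subnK qb) exprD take_polyMXn_0 drop_polyMXn_id.
by rewrite scaler0 add0r mulrDl -scalerAl -exprS mul_polyC.
Qed.

Lemma size_linear_polyY p1 p0 :
  (size (p1 *: 'X + p0%:P : {poly {poly L}})%R <= 2)%N.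
Proof.
apply: (leq_trans (size_polyD _ _)); rewrite geq_max.
by rewrite (leq_trans (size_scale_leq _ _)) ?size_polyX //= size_polyC; case: (p0 != 0).
Qed.

Lemma size_reduce u : (0 < q)%N -> (size u <= q.*2.-1)%N -> (size (reduce u) <= q)%N.
Proof.
move=> q_gt0 szu; apply: (leq_trans (size_polyD _ _)); rewrite geq_max; apply/andP; split.
  by apply: (leq_trans (size_scale_leq _ _)); rewrite size_take_poly.
apply: (leq_trans (size_polyMleq _ _)); rewrite size_drop_poly.
have := size_linear_polyY 'X g; lia.
Qed.

Hypothesis size_g : (size g <= 3)%N.

Lemma sizeY_reduce u : (sizeY (reduce u) <= (sizeY u).+2)%N.
Proof.
have take_leq : (sizeY (take_poly q u) <= sizeY u)%N.
  apply: sizeY_leq => i; rewrite coef_take_poly; case: ifP => _.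
    exact: max_size_coefXY.
  by rewrite size_poly0.
have drop_leq : (sizeY (drop_poly q u) <= sizeY u)%N.
  by apply: sizeY_leq => i; rewrite coef_drop_poly max_size_coefXY.
have factor_leq : (sizeY ('X *: 'X + g%:P : {poly {poly L}}) <= 3)%N.
  apply: (leq_trans (sizeYD _ _)); rewrite geq_max sizeY_polyC size_g andbT.
  by apply: (leq_trans (sizeYZ _ _)); rewrite size_polyX (sizeY_polyXn _ 1).
apply: (leq_trans (sizeYD _ _)); rewrite geq_max; apply/andP; split.
  by apply: (leq_trans (sizeYZ _ _)); rewrite size_polyX /=; lia.
by apply: (leq_trans (sizeYM _ _)); lia.
Qed.

(* Substituting [x := X^q], [y := X] turns the pole order at infinity, where
   [x] has weight [q] and [y] weight [1], into an ordinary degree. *)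
Definition weight_poly u : {poly L} :=
  (map_poly (comp_poly 'X^q) u).['X].

Fact weight_poly_is_nmod_morphism : nmod_morphism weight_poly.
Proof. by split=> [|u v]; rewrite /weight_poly ?rmorph0 ?horner0 ?rmorphD ?hornerD. Qed.

HB.instance Definition _ :=
  GRing.isNmodMorphism.Build {poly {poly L}} {poly L} weight_poly
    weight_poly_is_nmod_morphism.

Lemma weight_polyZ p u : weight_poly (p *: u) = (p \Po 'X^q) * weight_poly u.
Proof. by rewrite /weight_poly map_polyZ hornerZ. Qed.

Hypothesis q_gt0 : (0 < q)%N.

Lemma size_weight_polyZXn p b : p != 0 ->
  size (weight_poly (p *: 'X^b)) = ((size p).-1 * q + b).+1.
Proof.
move=> p0; have comp0 : p \Po 'X^q != 0 by rewrite comp_poly_eq0 ?size_polyXn.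
rewrite weight_polyZ /weight_poly map_polyXn hornerXn size_mulXn // addnC.
rewrite -[size (_ \Po _)]prednK ?size_poly_gt0 // size_comp_poly size_polyXn.
by rewrite addSn.
Qed.

Lemma size_weight_reduce_small p b : p != 0 -> (b < q)%N ->
  size (weight_poly (reduce (p *: 'X^b))) = ((size p).-1 * q + b + q).+1.
Proof.
move=> p0 bq; rewrite linearZ /= reduceXn_small // scalerA.
rewrite size_weight_polyZXn ?mulf_neq0 ?polyX_eq0 // size_mulX //=.
by move: p0; rewrite -size_poly_gt0; move: (size p) => n; nia.
Qed.

Lemma size_weight_reduce_leq p b : p != 0 ->
  (size (weight_poly (reduce (p *: 'X^b))) <= ((size p).-1 * q + b + q).+1)%N.
Proof.
move=> p0; have [bq | qb] := ltnP b q; first by rewrite size_weight_reduce_small.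
rewrite linearZ /= reduceXn_large // scalerDr !scalerA raddfD /=.
have p_gt0 : (0 < size p)%N by rewrite size_poly_gt0.
apply: (leq_trans (size_polyD _ _)); rewrite geq_max; apply/andP; split.
  rewrite size_weight_polyZXn ?mulf_neq0 ?polyX_eq0 // size_mulX //=.
  by move: (size p) p_gt0 => n; nia.
have [-> | g0] := eqVneq g 0.
  by rewrite mulr0 scale0r raddf0 size_poly0.
have g_gt0 : (0 < size g)%N by rewrite size_poly_gt0.
rewrite size_weight_polyZXn ?mulf_neq0 // size_mul //.
move: (size p) (size g) p_gt0 g_gt0 size_g => n m; nia.
Qed.

End Reduction.

Section CurveTerm.

Variables (L : fieldType) (q D : nat) (A : {poly L}).
Let r := (q * D)%N.

(* [x^(e + r) * y^j * (y + A/x^D)^l] with denominators cleared; on the curve it is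
   [x^(e + r) * y^(j + r * l)]. *)
Definition curve_term e j l : {poly {poly L}} :=
  'X^(e + D * (q - l)) *: ('X^j * ('X^D *: 'X + A%:P) ^+ l).

Lemma size_curve_term e j l : (j < q)%N -> (l < q)%N ->
  (size (curve_term e j l) <= q.*2.-1)%N.
Proof.
move=> jq lq; apply: (leq_trans (size_scale_leq _ _)).
apply: (leq_trans (size_polyMleq _ _)); rewrite size_polyXn.
have := size_poly_exp_leq ('X^D *: 'X + A%:P : {poly {poly L}}) l.
have := size_linear_polyY 'X^D A; move: (size _) (size _) => s1 s2; nia.
Qed.

Lemma horner2_curve_term x y e j l : (l <= q)%N ->
    A.[x] = x ^+ D * (y ^+ r - y) ->
  (curve_term e j l).[y, x] = x ^+ (e + r) * y ^+ (j + r * l).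
Proof.
move=> lq Ax; rewrite /curve_term !hornerE ?horner_exp ?hornerE /=.
rewrite Ax -mulrDr addrC subrK exprMn -!exprM mulrACA -!exprD.
by congr (x ^+ _ * _); rewrite /r; nia.
Qed.

Hypothesis size_A : size A = (D.*2).+1.

Lemma sizeY_curve_term e j l : (l < q)%N ->
  (sizeY (curve_term e j l) <= (e + r.*2 - D).+1)%N.
Proof.
move=> lq.
have factor_leq : (sizeY ('X^D *: 'X + A%:P : {poly {poly L}}) <= D.*2.+1)%N.
  apply: (leq_trans (sizeYD _ _)); rewrite geq_max sizeY_polyC size_A leqnn andbT.
  by apply: (leq_trans (sizeYZ _ _)); rewrite size_polyXn (sizeY_polyXn _ 1); lia.
have := sizeY_exp ('X^D *: 'X + A%:P) l.
have := sizeYM 'X^j (('X^D *: 'X + A%:P : {poly {poly L}}) ^+ l).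
have := sizeYZ 'X^(e + D * (q - l)) ('X^j * ('X^D *: 'X + A%:P : {poly {poly L}}) ^+ l).
rewrite -/(curve_term e j l) size_polyXn sizeY_polyXn /r.
move: factor_leq; move: (sizeY _) (sizeY _) (sizeY _) (sizeY _) => s1 s2 s3 s4.
nia.
Qed.

Lemma curve_term_sum e j l : curve_term e j l =
  \sum_(t < l.+1) ('X^(e + D * (q - l) + D * t) * A ^+ (l - t)) *: 'X^(j + t) *+ 'C(l, t).
Proof.
rewrite /curve_term addrC exprDn mulr_sumr scaler_sumr; apply: eq_bigr => t _.
rewrite mulrnAr -scalerMnr; congr (_ *+ _).
rewrite exprZn -polyC_exp -scalerAr mul_polyC scalerA -scalerAr -exprD scalerA.
by congr (_ *: _); rewrite -exprM mulrA -exprD.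
Qed.

Lemma size_curve_term_coef a n : size ('X^a * A ^+ n) = (a + D.*2 * n).+1.
Proof.
have A0 : A ^+ n != 0 by rewrite expf_neq0 // -size_poly_eq0 size_A.
rewrite mulrC size_mulXn // -[size (A ^+ n)]prednK ?size_poly_gt0 //.
by rewrite size_exp size_A addnS.
Qed.

Variable g : {poly L}.
Hypothesis q_gt1 : (1 < q)%N.
Hypothesis D_gt0 : (0 < D)%N.
Hypothesis size_g : (size g <= 3)%N.

(* Only the term [t = 0] of [curve_term_sum] reaches the top degree. *)
Lemma size_weight_curve_term e j l : (j < q)%N -> (l < q)%N ->
  size (weight_poly q (reduce q g (curve_term e j l))) =
  (q * e + j + r * l + (q + r * q)).+1.
Proof.
move=> jq lq; have q_gt0 := ltnW q_gt1.
pose coef t := 'X^(e + D * (q - l) + D * t) * A ^+ (l - t).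
pose term t := weight_poly q (reduce q g (coef t *: 'X^(j + t))).
have size_coef t : size (coef t) = (e + D * (q - l) + D * t + D.*2 * (l - t)).+1.
  exact: size_curve_term_coef.
have coef_neq0 t : coef t != 0 by rewrite -size_poly_eq0 size_coef.
have size_term0 : size (term 0%N) = (q * e + j + r * l + (q + r * q)).+1.
  by rewrite /term size_weight_reduce_small ?addn0 ?size_coef //= /r; nia.
have -> : weight_poly q (reduce q g (curve_term e j l)) =
    \sum_(t < l.+1) term t *+ 'C(l, t).
  rewrite curve_term_sum !raddf_sum; apply: eq_bigr => t _.
  by rewrite !raddfMn.
rewrite big_ord_recl /= bin0 mulr1n size_polyDl size_term0 // ltnS.
apply: (leq_trans (size_sum _ _ _)); apply/bigmax_leqP => t _.
rewrite -scaler_nat (leq_trans (size_scale_leq _ _)) //.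
apply: (leq_trans (size_weight_reduce_leq size_g q_gt0 _ _)) => //.
by rewrite size_coef /= /bump /= add1n; have := ltn_ord t; nia.
Qed.

End CurveTerm.

Lemma card_full_fibers_lt_sizeY (K : finFieldType) (h : {poly {poly K}})
    (Z : {set K}) (S : K -> {set K}) : h != 0 ->
    (forall x, x \in Z -> (size h <= #|S x|)%N /\ forall y, y \in S x -> h.[y, x] = 0) ->
  (#|Z| < sizeY h)%N.
Proof.
move=> h0 vanish; apply: leq_trans (max_size_lead_coefXY h).
apply: card_roots_lt_size => [|x /vanish[size_h Sx_roots]].
  by rewrite lead_coef_eq0.
pose hx := map_poly (horner_eval x) h.
suff /eqP hx0 : hx == 0.
  by rewrite rootE lead_coefE -[_.[x]](coef_map (horner_eval x)) -/hx hx0 coef0.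
apply: contraTT size_h => hx0; rewrite -ltnNge.
apply: (@leq_trans (size hx)); last exact: size_poly.
apply: card_roots_lt_size => // y /Sx_roots hyx.
by rewrite rootE /hx -horner_swapXY horner2_swapXY hyx.
Qed.

Lemma horner2_linear_combination (K : comNzRingType) (T : finType) (c : T -> K)
    (u : T -> {poly {poly K}}) x y :
  (\sum_t (c t)%:P *: u t).[y, x] = \sum_t c t * (u t).[y, x].
Proof. by rewrite !horner_sum; apply: eq_bigr => t _; rewrite !hornerE. Qed.

Section Stepanov.

Variables (L : finFieldType) (q D : nat) (g A : {poly L}).
Hypothesis q_gt1 : (1 < q)%N.
Let r := (q * D)%N.
Hypothesis r_gt2 : (2 < r)%N.
Hypothesis size_g : (size g <= 3)%N.
Hypothesis size_A : size A = (D.*2).+1.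
Hypothesis pchar_r : [pchar L].-nat r.
Hypothesis card_L : #|L| = (r ^ 2)%N.

Let D_gt0 : (0 < D)%N.
Proof. by move: r_gt2; rewrite /r; case: D => //; rewrite muln0. Qed.

Definition on_curve (x y : L) : bool :=
  [&& x != 0, x * y ^+ q == x * y + g.[x] & A.[x] == x ^+ D * (y ^+ r - y)].

(* The index [((i, l), (k, j))] stands for the functions [(x^k y^j) (x^i y^l)^r]
   and [(x^k y^j)^r (x^i y^l)], represented by [stepanov_term] and
   [stepanov_dual_term] up to the factor [x^(r + 1)] on the curve. Since
   [z^(r^2) = z] on [L], the [r]-th power of a combination of the former with
   coefficients [c t] is the combination of the latter with coefficients [c t ^+ r]. *)
Let T : finType := ('I_(D + 4) * 'I_q * ('I_D * 'I_q))%type.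

Definition stepanov_term (t : T) : {poly {poly L}} :=
  reduce q g (curve_term q D A (t.2.1 + t.1.1 * r) t.2.2 t.1.2).

Definition stepanov_dual_term (t : T) : {poly {poly L}} :=
  reduce q g (curve_term q D A (t.2.1 * r + t.1.1) t.1.2 t.2.2).

Let expr_r2 (x : L) : (x ^+ r) ^+ r = x.
Proof. by rewrite -exprM mulnn -card_L expf_card. Qed.

Let size_reduce_curve_term e j l : (j < q)%N -> (l < q)%N ->
  (size (reduce q g (curve_term q D A e j l)) <= q)%N.
Proof. by move=> jq lq; rewrite size_reduce ?size_curve_term // ltnW. Qed.

Let sizeY_reduce_curve_term e j l : (l < q)%N ->
  (sizeY (reduce q g (curve_term q D A e j l)) <= (e + r.*2 - D).+3)%N.
Proof.
move=> lq; apply: (leq_trans (sizeY_reduce q size_g _)).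
by rewrite !ltnS sizeY_curve_term.
Qed.

Lemma vanishing_dual_combination_exists : exists c : T -> L, (exists t, c t != 0) /\
  \sum_t (c t ^+ r)%:P *: stepanov_dual_term t = 0.
Proof.
pose W := ((D + 1) * r + 6)%N.
have [] := @homogeneous_system_nontrivial L T ('I_q * 'I_W)%type
  (fun t u => (stepanov_dual_term t)`_u.1`_u.2).
  rewrite !card_prod !card_ord /W; move: r_gt2; rewrite /r; nia.
move=> c [[t ct] c_kernel]; exists (fun t => c t ^+ r); split.
  by exists t; rewrite expf_neq0.
under eq_bigr do rewrite expr_r2.
apply/polyP => b; rewrite coef0; apply/polyP => n; rewrite coef0 coef_sum.
under eq_bigr do rewrite coefZ.
have [bq | qb] := ltnP b q; last first.
  rewrite big1 ?coef0 // => u _; rewrite nth_default ?mulr0 //.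
  by apply: leq_trans qb; apply: size_reduce_curve_term.
rewrite coef_sum; under eq_bigr do rewrite coefCM.
have [nW | Wn] := ltnP n W; first exact: (c_kernel (Ordinal bq, Ordinal nW)).
rewrite big1 // => u _; rewrite nth_default ?mulr0 //.
apply: leq_trans Wn; apply: leq_trans (max_size_coefXY _ _) _.
apply: leq_trans (sizeY_reduce_curve_term _ _ (ltn_ord _)) _.
by have := ltn_ord u.2.1; have := ltn_ord u.1.1; rewrite /W /r; nia.
Qed.

Definition stepanov_combination (c : T -> L) : {poly {poly L}} :=
  \sum_t (c t)%:P *: stepanov_term t.

Lemma stepanov_combination_neq0 c :
  (exists t, c t != 0) -> stepanov_combination c != 0.
Proof.
pose weight (t : T) :=
  (t.2.2 + q * t.2.1 + r * (t.1.2 + q * t.1.1) + (q + r * q))%N.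
move=> c_neq0; apply: contraNneq (sum_distinct_degrees_neq0
  (P := fun t => weight_poly q (stepanov_term t)) (deg := weight) _ _ c_neq0)
  => [h0 | |].
- apply/eqP; rewrite -[RHS](raddf0 (weight_poly q)) -h0 raddf_sum.
  by apply: eq_bigr => t _; rewrite /= weight_polyZ comp_polyC mul_polyC.
- move=> [[i l] [k j]] [[i' l'] [k' j']] /addIn /= weight_eq.
  have low_lt (k0 : 'I_D) (j0 : 'I_q) : (j0 + q * k0 < r)%N.
    by have := ltn_ord k0; have := ltn_ord j0; rewrite /r; nia.
  have [low_eq high_eq] := add_muln_inj (low_lt k j) (low_lt k' j') weight_eq.
  have [/val_inj-> /val_inj->] := add_muln_inj (ltn_ord j) (ltn_ord j') low_eq.
  by have [/val_inj-> /val_inj->] := add_muln_inj (ltn_ord l) (ltn_ord l') high_eq.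
- move=> t; rewrite /stepanov_term size_weight_curve_term // /weight /r.
  by congr _.+1; nia.
Qed.

Lemma size_stepanov_combination c : (size (stepanov_combination c) <= q)%N.
Proof.
apply: (leq_trans (size_sum _ _ _)); apply/bigmax_leqP => t _.
by apply: (leq_trans (size_scale_leq _ _)); apply: size_reduce_curve_term.
Qed.

Lemma sizeY_stepanov_combination c :
  (sizeY (stepanov_combination c) <= (D + 6) * r)%N.
Proof.
apply: (leq_trans (sizeY_sum _)); apply/bigmax_leqP => t _.
apply: (leq_trans (sizeYZ _ _)).
have : (size (c t)%:P <= 1)%N by rewrite size_polyC leq_b1.
have := sizeY_reduce_curve_term (t.2.1 + t.1.1 * r) t.2.2 (ltn_ord t.1.2).
have := ltn_ord t.2.1; have := ltn_ord t.1.1; rewrite -/(stepanov_term t).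
move: (sizeY _) (size _) => s1 s2; move: r_gt2; rewrite /r; nia.
Qed.

Lemma stepanov_combination_on_curve c x y :
    \sum_t (c t ^+ r)%:P *: stepanov_dual_term t = 0 -> on_curve x y ->
  (stepanov_combination c).[y, x] = 0.
Proof.
move=> dual0 /and3P[x0 /eqP xy /eqP Axy].
have eval_term e j l : (l < q)%N -> (reduce q g (curve_term q D A e j l)).[y, x] =
    x ^+ r.+1 * (x ^+ e * y ^+ (j + r * l)).
  move=> lq; rewrite horner2_reduce // (horner2_curve_term _ _ (ltnW lq) Axy).
  by rewrite mulrA -exprS [(e + _)%N]addnC -addSn exprD -mulrA.
pose f := \sum_t c t * (x ^+ (t.2.1 + t.1.1 * r) * y ^+ (t.2.2 + r * t.1.2)).
have -> : (stepanov_combination c).[y, x] = x ^+ r.+1 * f.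
  rewrite horner2_linear_combination mulr_sumr; apply: eq_bigr => t _.
  by rewrite eval_term // mulrCA.
suff /eqP : x ^+ r.+1 * f ^+ r = 0.
  by rewrite mulf_eq0 !expf_eq0 (negPf x0) andbF /= => /andP[_ /eqP->]; rewrite mulr0.
have := horner2_linear_combination (fun t => c t ^+ r) stepanov_dual_term x y.
rewrite dual0 !horner0 => ->; rewrite expr_sum_pchar // mulr_sumr.
apply: eq_bigr => t _; rewrite eval_term // !exprMn [LHS]mulrCA.
congr (_ * (_ * (_ * _))).
  by rewrite !exprD exprMn [(x ^+ (_ * r))]exprM expr_r2 -exprM.
by rewrite !exprD exprMn mulnC [(y ^+ (_ * r))]exprM expr_r2 -exprM mulrC mulnC.
Qed.

Theorem stepanov_bound (S Z : {set L}) : (q <= #|S|)%N ->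
    (forall x, x \in Z -> exists y, forall s, s \in S -> on_curve x (y + s)) ->
  (#|Z| < (D + 6) * r)%N.
Proof.
move=> qS Z_curve; have [c [c_neq0 dual0]] := vanishing_dual_combination_exists.
apply: leq_trans (sizeY_stepanov_combination c).
apply: (@card_full_fibers_lt_sizeY _ _ _ (fun x => [set y | on_curve x y])).
  exact: stepanov_combination_neq0.
move=> x /Z_curve[y y_curve]; split; last first.
  by move=> z; rewrite inE; apply: stepanov_combination_on_curve.
apply: leq_trans (size_stepanov_combination c) (leq_trans qS _).
rewrite -(card_imset S (addrI y)); apply: subset_leq_card.
by apply/subsetP => _ /imsetP[s sS ->]; rewrite inE y_curve.
Qed.

End Stepanov.

(** * Artin-Schreier curves *)

Record trace_form (F L : finFieldType) (iota : {rmorphism F -> L}) (tau : L -> F) :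
    Prop := TraceForm {
  trace_formD : {morph tau : x y / x + y};
  trace_formZ : forall s x, tau (iota s * x) = s * tau x;
  trace_form_frobenius : forall x, tau (x ^+ #|F|) = tau x;
  trace_form_nontrivial : exists x, tau x != 0 }.

Section ArtinSchreier.

Variables (F L : finFieldType) (iota : {rmorphism F -> L}) (m : nat).
Let q := #|F|.
Let D := (q ^ m)%N.
Let r := (q * D)%N.
Hypothesis q_gt2 : (2 < q)%N.
Hypothesis card_L : #|L| = (r ^ 2)%N.
Variables (a b : L).
Hypothesis a0 : a != 0.

Let D_gt0 : (0 < D)%N. Proof. by rewrite expn_gt0 (ltnW (ltnW q_gt2)). Qed.
Let r_gt2 : (2 < r)%N. Proof. by rewrite /r; move: q_gt2 D_gt0; nia. Qed.
Let pchar_q : [pchar L].-nat q.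
Proof.
apply: pnat_dvd (pchar_nat_card L).
by rewrite card_L expnMn dvdn_mulr // dvdn_exp.
Qed.
Let pchar_r : [pchar L].-nat r.
Proof. by rewrite pnatM pchar_q pnatX pchar_q. Qed.

Definition artin_schreier_image : {set L} := [set y ^+ q - y | y : L].

Definition artin_schreier_fiber (c : L) : {set L} :=
  [set x | (x != 0) && (a * x + b / x - c \in artin_schreier_image)].

Let W := artin_schreier_image.

Lemma artin_schreier_imageD w w' : w \in W -> w' \in W -> w + w' \in W.
Proof.
move=> /imsetP[y _ ->] /imsetP[y' _ ->]; apply/imsetP; exists (y + y') => //.
by rewrite exprDn_pchar // opprD addrACA.
Qed.

Lemma leq_card_artin_schreier_image : (#|L| <= q * #|W|)%N.
Proof.
rewrite -cardsT; apply: (leq_card_fibers (f := fun y => y ^+ q - y)) => [y _|w _].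
  exact: imset_f.
have q_gt1 := ltnW q_gt2.
have size_XqBXBw : size ('X^q - ('X + w%:P) : {poly L}) = q.+1.
  by rewrite size_polyDl size_polyXn // size_polyN size_XaddC.
rewrite -ltnS -[X in (_ < X)%N]size_XqBXBw.
apply: card_roots_lt_size; first by rewrite -size_poly_eq0 size_XqBXBw.
by move=> y; rewrite !inE rootE !hornerE opprD addrA subr_eq0.
Qed.

Lemma sum_card_artin_schreier_fibers :
  (\sum_c #|artin_schreier_fiber c| = #|L|.-1 * #|W|)%N.
Proof.
under eq_bigr do rewrite -sum1_card big_mkcond /=.
rewrite exchange_big /= (bigD1 0) //= big1 ?add0n => [|c _]; last by rewrite inE eqxx.
rewrite (eq_bigr (fun _ => #|W|)) => [|x x0]; last first.
  rewrite -big_mkcond /= sum1dep_card -(card_imset W (inv_inj (subKr (a * x + b / x)))).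
  apply: eq_card => c; rewrite !inE x0 /=.
  apply/idP/imsetP => [cW|[w wW ->]]; last by rewrite subKr.
  by exists (a * x + b / x - c) => //; rewrite subKr.
by rewrite sum_nat_const cardC1.
Qed.

(* On [y^q - y = a x + b / x - c] the function [numerator c] is [x (y^q - y)];
   [frobenius_sum c] is [x^D] times the sum of the [q^i]-th powers of [y^q - y],
   which telescopes to [y^r - y]. *)
Let numerator (c : L) : {poly L} := a *: 'X^2 + (- c) *: 'X + b%:P.
Let frobenius_sum (c : L) : {poly L} :=
  \sum_(i < m.+1) 'X^(D - q ^ i) * numerator c ^+ (q ^ i).

Let size_frobenius_sum c : size (frobenius_sum c) = (D.*2).+1.
Proof.
have size_summand i : (q ^ i <= D)%N ->
    size ('X^(D - q ^ i) * numerator c ^+ (q ^ i)) = (D + q ^ i).+1.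
  move=> iD; have size_num := size_quadratic (- c) b a0.
  have num0 : numerator c ^+ (q ^ i) != 0.
    by rewrite expf_neq0 // -size_poly_eq0 size_num.
  have size_numX : size (numerator c ^+ (q ^ i)) = (2 * q ^ i).+1.
    by rewrite -[LHS]prednK ?size_poly_gt0 // size_exp size_num.
  by rewrite mulrC size_mulXn // size_numX; lia.
rewrite /frobenius_sum big_ord_recr /= addrC size_polyDl size_summand ?addnn //.
rewrite ltnS; apply: (leq_trans (size_sum _ _ _)); apply/bigmax_leqP => i _.
have im : (q ^ i < D)%N by rewrite ltn_exp2l // ltnW.
by rewrite size_summand; lia.
Qed.

Lemma artin_schreier_on_curve c x y : x != 0 -> y ^+ q - y = a * x + b / x - c ->
  on_curve q D (numerator c) (frobenius_sum c) x y.
Proof.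
move=> x0 xy; have num_x : (numerator c).[x] = x * (y ^+ q - y).
  by rewrite xy /numerator !hornerE /=; field.
apply/and3P; split=> //; first by rewrite num_x mulrBr addrC subrK.
rewrite /frobenius_sum horner_sum (eq_bigr (fun i : 'I_m.+1 =>
    x ^+ D * (y ^+ (q ^ i.+1) - y ^+ (q ^ i)))) => [|i _]; last first.
  have pchar_qi : [pchar L].-nat (q ^ i)%N by rewrite pnatX pchar_q.
  rewrite hornerM hornerXn horner_exp num_x exprMn mulrA -exprD.
  rewrite subnK ?leq_exp2l ?(ltnW q_gt2) -1?ltnS //; congr (_ * _).
  apply/eqP; rewrite eq_sym subr_eq -exprDn_pchar // subrK.
  by rewrite expnS exprM.
rewrite -mulr_sumr.
rewrite -(big_mkord xpredT (fun i => y ^+ (q ^ i.+1) - y ^+ (q ^ i))) telescope_sumr //.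
by rewrite expn0 expr1 expnS.
Qed.

Lemma card_artin_schreier_fiber_lt c : (#|artin_schreier_fiber c| < (D + 6) * r)%N.
Proof.
apply: (@stepanov_bound L q D (numerator c) (frobenius_sum c) _ _ _ _ _ _
  (iota @: [set: F])) => //.
- exact: ltnW.
- by rewrite size_quadratic.
- by rewrite card_imset ?cardsT //; exact: fmorph_inj.
move=> x; rewrite inE => /andP[x0 /imsetP[y _ xy]].
exists y => _ /imsetP[s _ ->]; apply: artin_schreier_on_curve => //.
by rewrite exprDn_pchar // -rmorphXn expf_card opprD addrACA subrr addr0 -xy.
Qed.

(* The fibers over [c] in the image of [y^q - y] lie in the set counted here, while
   the others have at most [(D + 6) r] elements; the sizes of all fibers add up to
   [(r^2 - 1) #|W|]. *)
Lemma card_trace_form_zeros_lb (tau : L -> F) : trace_form iota tau ->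
  (#|L| <= q * #|[set x : L | (x != 0)%R && (tau (a * x + b / x) == 0)%R]|
             + 7 * q ^ 2 * r)%N.
Proof.
move=> tauP; set N0 := [set x | _ ].
have tau_image w : w \in W -> tau w = 0.
  move=> /imsetP[y _ ->]; apply: (@addIr _ (tau y)).
  by rewrite add0r -(trace_formD tauP) subrK (trace_form_frobenius tauP).
have fiber_sub c : c \in W -> (#|artin_schreier_fiber c| <= #|N0|)%N.
  move=> cW; apply: subset_leq_card; apply/subsetP => x; rewrite !inE => /andP[-> xW].
  by apply/eqP/tau_image; rewrite -[a * x + b / x](subrK c) artin_schreier_imageD.
have sum_leq : (#|L|.-1 * #|W| <= #|W| * #|N0| + (#|L| - #|W|) * ((D + 6) * r))%N.
  rewrite -sum_card_artin_schreier_fibers (bigID (mem W)) /= leq_add //.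
    by rewrite -sum_nat_const leq_sum.
  rewrite -(cardsC W) addKn -sum_nat_const.
  under [X in (_ <= X)%N]eq_bigl do rewrite inE.
  by apply: leq_sum => c _; apply/ltnW/card_artin_schreier_fiber_lt.
have W_gt0 : (0 < #|W|)%N by apply/card_gt0P; exists (1 ^+ q - 1); apply: imset_f.
have card_LE : #|L| = (q * (D * r))%N by rewrite card_L -mulnn {1}/r mulnA.
have compl_leq : (#|L| - #|W| <= q.-1 * #|W|)%N.
  rewrite leq_subLR -mulSn prednK ?leq_card_artin_schreier_image //.
  exact: ltnW (ltnW _).
have : (#|L|.-1 * #|W| <= (#|N0| + q.-1 * ((D + 6) * r)) * #|W|)%N.
  apply: (leq_trans sum_leq); rewrite [leqRHS]mulnDl.
  by rewrite [(#|W| * _)%N]mulnC leq_add2l [leqRHS]mulnAC leq_mul2r compl_leq orbT.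
rewrite leq_pmul2r // card_LE mulnDl -mulnn => zeros_lb.
have -> : (7 * (q * q) * r = q * (7 * (q * r)))%N by ring.
rewrite -mulnDr leq_pmul2l; last exact: ltnW (ltnW _).
move: zeros_lb q_gt2 r_gt2; move: q r (D * r)%N #|N0| => [|k] r' X n //=; nia.
Qed.

End ArtinSchreier.

(** * Kloosterman sums *)

Record add_char (V : finZmodType) (psi : V -> algC) : Prop := AddChar {
  add_char0 : psi 0 = 1;
  add_charD : forall x y, psi (x + y) = psi x * psi y;
  add_char_nontrivial : exists x, psi x != 1 }.

Section AddChar.

Variables (V : finZmodType) (psi : V -> algC).
Hypothesis psiC : add_char psi.

Lemma add_charMn x n : psi (x *+ n) = psi x ^+ n.
Proof.
elim: n => [|n IH]; first by rewrite mulr0n expr0 add_char0.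
by rewrite mulrS exprS add_charD // IH.
Qed.

Lemma add_char_bigsum (I : Type) (s : seq I) (P : pred I) (f : I -> V) :
  psi (\sum_(i <- s | P i) f i) = \prod_(i <- s | P i) psi (f i).
Proof. exact: (big_morph psi (add_charD psiC) (add_char0 psiC)). Qed.

Lemma add_char_norm x : `|psi x| = 1.
Proof.
have xV0 : x *+ #|V| = 0 by rewrite -cardsT; exact: expg_cardG (in_setT x).
apply/eqP; rewrite -(@pexpr_eq1 _ _ #|V|) //; last by apply/card_gt0P; exists x.
by rewrite -normrX -add_charMn xV0 add_char0 ?normr1.
Qed.

Lemma add_char_conj x : (psi x)^* = psi (- x).
Proof.
have psi0 : psi x != 0 by rewrite -normr_eq0 add_char_norm oner_eq0.
apply: (mulfI psi0); rewrite -normCK add_char_norm expr1n.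
by rewrite -add_charD // subrr add_char0.
Qed.

Lemma add_char_sum : \sum_x psi x = 0.
Proof.
have [y psiy] := add_char_nontrivial psiC; apply: (mulfI (x := psi y - 1)).
  by rewrite subr_eq0.
rewrite mulr0 mulrBl mul1r mulr_sumr [X in _ - X](reindex_inj (addrI y)) /=.
by under [X in _ - X]eq_bigr do rewrite add_charD //; rewrite subrr.
Qed.

End AddChar.

Lemma add_char_sumM (F : finFieldType) (psi : F -> algC) (c : F) : add_char psi ->
  \sum_x psi (c * x) = (c == 0)%:R * #|F|%:R.
Proof.
move=> psiC; have [->|c0] := eqVneq c 0.
  rewrite mul1r (eq_bigr (fun _ => 1)) => [|x _]; last by rewrite mul0r add_char0.
  by rewrite sumr_const.
by rewrite mul0r -[RHS](add_char_sum psiC) [RHS](reindex_inj (mulfI c0)).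
Qed.

Lemma add_char_exists (F : finFieldType) : exists psi : F -> algC, add_char psi.
Proof.
have [p pr_p pF] := finPcharP F.
have [z zp] := C_prim_root_exists (prime_gt0 pr_p).
pose V : vectType 'F_p := pPrimeCharType pF.
pose X := vbasis {:V}.
have [i coord1] : exists i, coord X i (1 : F) != 0.
  apply/existsP; apply: contraR (oner_neq0 F); rewrite negb_exists => /forallP coord1.
  rewrite (coord_vbasis (memvf (1 : V))) big1 // => i _.
  by have := coord1 i; rewrite negbK => /eqP ->; rewrite scale0r.
exists (fun x : F => z ^+ (coord X i (x : V) : 'F_p)); split.
- by rewrite linear0 expr0.
- move=> x y; rewrite (linearD (coord X i)) -exprD; apply/eqP.
  rewrite (eq_prim_root_expr zp).
  have FpD (u v : 'F_p) : ((u + v)%R : nat) = ((u + v) %% p)%N.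
    exact: (congr1 (modn (u + v)) (Fp_cast pr_p)).
  by rewrite FpD modn_mod.
exists 1; rewrite -(prim_order_dvd zp); apply: contra coord1 => p_dvd.
have coord_lt : (coord X i (1 : V) < p)%N.
  exact: leq_trans (ltn_ord _) (eq_leq (Fp_cast pr_p)).
apply/eqP/val_inj => /=; move: p_dvd coord_lt; case: (nat_of_ord _) => // n.
by move=> /dvdn_leq le_pn; rewrite ltnNge le_pn.
Qed.

Lemma trace_form_add_char (F L : finFieldType) (iota : {rmorphism F -> L})
    (tau : L -> F) (psi : F -> algC) : trace_form iota tau -> add_char psi ->
  add_char (psi \o tau).
Proof.
move=> tauP psiC; split=> [|x y|] /=.
- by rewrite -(mul0r 0) -(rmorph0 iota) (trace_formZ tauP) mul0r add_char0.
- by rewrite (trace_formD tauP) add_charD.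
have [x psix] := add_char_nontrivial psiC; have [y tauy] := trace_form_nontrivial tauP.
by exists (iota (x / tau y) * y); rewrite (trace_formZ tauP) divfK.
Qed.

Definition kloosterman (F : finFieldType) (psi : F -> algC) (a b : F) : algC :=
  \sum_(x | x != 0) psi (a * x + b / x).

Lemma kloosterman_real (F : finFieldType) (psi : F -> algC) (a b : F) : add_char psi ->
  kloosterman psi a b \is Num.real.
Proof.
move=> psiC; apply/CrealP; rewrite /kloosterman rmorph_sum /= (reindex_inj oppr_inj) /=.
under eq_bigl do rewrite oppr_eq0.
by apply: eq_bigr => x _; rewrite add_char_conj // invrN !mulrN -opprD opprK.
Qed.

Section QuadraticExtension.

Variables (K L : finFieldType) (iota : {rmorphism K -> L}).
Let Q := #|K|.
Hypothesis card_L : #|L| = (Q ^ 2)%N.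

Let pchar_Q : [pchar L].-nat Q.
Proof. by apply: pnat_dvd (pchar_nat_card L); rewrite card_L dvdn_exp. Qed.

Let iota_inj : injective iota := fmorph_inj iota.

Lemma frobenius_fixed (v : L) : v ^+ Q = v -> exists u, iota u = v.
Proof.
move=> v_fixed; have : (map_poly iota ('X^#|K| - 'X)).[v] = 0.
  by rewrite rmorphB /= map_polyXn map_polyX !hornerE ?hornerXn v_fixed subrr.
rewrite finField_genPoly rmorph_prod /= horner_prod => /eqP.
rewrite prodf_seq_eq0 => /hasP[u _ /andP[_]]; rewrite rmorphB /= map_polyX map_polyC /=.
by rewrite !hornerE subr_eq0 => /eqP->; exists u.
Qed.

Let frobK (x : L) : (x ^+ Q) ^+ Q = x.
Proof. by rewrite -exprM mulnn -card_L expf_card. Qed.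

Let frobD (x y : L) : (x + y) ^+ Q = x ^+ Q + y ^+ Q.
Proof. exact: exprDn_pchar. Qed.

Let frob_iota u : iota u ^+ Q = iota u.
Proof. by rewrite -rmorphXn expf_card. Qed.

Definition qtrace (x : L) : K := odflt 0 [pick u | iota u == x + x ^+ #|K|].
Definition qnorm (x : L) : K := odflt 0 [pick u | iota u == x * x ^+ #|K|].

Lemma iota_qtrace x : iota (qtrace x) = x + x ^+ Q.
Proof.
rewrite /qtrace; case: pickP => [u /eqP//|no_preimage].
have [|u iota_u] := @frobenius_fixed (x + x ^+ Q); first by rewrite frobD frobK addrC.
by have := no_preimage u; rewrite iota_u eqxx.
Qed.

Lemma iota_qnorm x : iota (qnorm x) = x * x ^+ Q.
Proof.
rewrite /qnorm; case: pickP => [u /eqP//|no_preimage].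
have [|u iota_u] := @frobenius_fixed (x * x ^+ Q); first by rewrite exprMn frobK mulrC.
by have := no_preimage u; rewrite iota_u eqxx.
Qed.

Lemma qtraceD x y : qtrace (x + y) = qtrace x + qtrace y.
Proof. by apply: iota_inj; rewrite rmorphD !iota_qtrace frobD addrACA. Qed.

Lemma qtraceZ u x : qtrace (iota u * x) = u * qtrace x.
Proof. by apply: iota_inj; rewrite rmorphM !iota_qtrace exprMn frob_iota mulrDr. Qed.

Lemma qtrace_iota u : qtrace (iota u) = 2 * u.
Proof. by apply: iota_inj; rewrite iota_qtrace frob_iota mulr_natl rmorphMn mulr2n. Qed.

Lemma qtraceX x n : [pchar L].-nat n -> qtrace (x ^+ n) = qtrace x ^+ n.
Proof.
move=> pchar_n; apply: iota_inj.
by rewrite rmorphXn /= !iota_qtrace exprDn_pchar // exprAC.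
Qed.

Lemma qnorm_eq0 x : (qnorm x == 0) = (x == 0).
Proof.
rewrite -(fmorph_eq0 iota) iota_qnorm mulf_eq0 expf_eq0.
by case: (x == 0); rewrite ?andbF.
Qed.

Lemma qtraceV x : x != 0 -> qtrace x^-1 = qtrace x / qnorm x.
Proof.
move=> x0; apply: iota_inj.
have xQ0 : x ^+ Q != 0 by rewrite expf_neq0.
rewrite fmorph_div !iota_qtrace iota_qnorm exprVn; field; exact/andP.
Qed.

Lemma qtrace_qnorm_root x :
  1 * x ^+ 2 + - iota (qtrace x) * x + iota (qnorm x) = 0.
Proof. by rewrite iota_qtrace iota_qnorm; ring. Qed.

Lemma qtrace_qnorm_split x u v : qtrace x = u + v -> qnorm x = u * v ->
  x = iota u /\ v = u.
Proof.
move=> tr_x nm_x; have : (x - iota u) * (x - iota v) = 0.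
  by rewrite -[RHS](qtrace_qnorm_root x) tr_x nm_x rmorphD rmorphM; ring.
move/eqP; rewrite mulf_eq0 !subr_eq0 => /orP[] /eqP xE; move: tr_x.
  by rewrite xE qtrace_iota mulr_natl mulr2n => /addrI.
by rewrite xE qtrace_iota mulr_natl mulr2n => /addIr ->.
Qed.

Lemma card_qtrace_qnorm_leq2 (w : K * K) :
  (#|[set x | (qtrace x, qnorm x) == w]| <= 2)%N.
Proof.
apply: leq_trans (card_quadratic_roots_leq2 (- iota w.1) (iota w.2) (oner_neq0 L)).
apply: subset_leq_card; apply/subsetP => x; rewrite !inE => /eqP <- /=.
by rewrite qtrace_qnorm_root.
Qed.

Lemma card_sum_prod_leq2 (w : K * K) :
  (#|[set z : K * K | ((z.1 + z.2)%R, (z.1 * z.2)%R) == w]| <= 2)%N.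
Proof.
rewrite -(card_in_imset (f := fst)) => [|[x y] [x' y']]; last first.
  by rewrite !inE => /eqP <- /eqP[+ _] /= xx'; rewrite xx' => /addrI->.
apply: leq_trans (card_quadratic_roots_leq2 (- w.1) w.2 (oner_neq0 K)).
apply: subset_leq_card; apply/subsetP => _ /imsetP[[x y] + ->].
by rewrite !inE => /eqP <- /=; apply/eqP; ring.
Qed.

Lemma card_trace_norm_fibers (w : K * K) :
  (#|[set x | (qtrace x, qnorm x) == w]| +
   #|[set z : K * K | ((z.1 + z.2)%R, (z.1 * z.2)%R) == w]| = 2)%N.
Proof.
apply: card_fibersD_eq w => [w|]; last by rewrite card_prod card_L -/Q mulnn muln2 addnn.
have [-> | [z0 z0_w]] := set_0Vmem [set z : K * K | (z.1 + z.2, z.1 * z.2) == w].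
  by rewrite cards0 addn0 card_qtrace_qnorm_leq2.
have [-> | [x0 x0_w]] := set_0Vmem [set x | (qtrace x, qnorm x) == w].
  by rewrite cards0 card_sum_prod_leq2.
have split_w x z : x \in [set x | (qtrace x, qnorm x) == w] ->
    z \in [set z : K * K | (z.1 + z.2, z.1 * z.2) == w] -> x = iota z.1 /\ z.2 = z.1.
  by rewrite !inE => /eqP <- /eqP[/esym tr_x /esym nm_x]; apply: qtrace_qnorm_split.
rewrite -[2%N]/(1 + 1)%N leq_add //.
  rewrite -(cards1 (iota z0.1)); apply: subset_leq_card; apply/subsetP => x x_w.
  by rewrite inE; have [-> _] := split_w _ _ x_w z0_w.
rewrite -(cards1 (z0.1, z0.1)); apply: subset_leq_card; apply/subsetP => -[z1 z2] z_w.
have [x0E z2E] := split_w _ _ x0_w z_w; have [x0E' _] := split_w _ _ x0_w z0_w.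
by rewrite inE; move: z2E => /= ->; rewrite (iota_inj (etrans (esym x0E') x0E)).
Qed.

Lemma trace_form_qtrace (F : finFieldType) (j : {rmorphism F -> K}) (tau : K -> F) :
    2 != 0 :> K -> trace_form j tau ->
  trace_form (iota \o j : {rmorphism F -> L}) (tau \o qtrace).
Proof.
move=> K2 tauP; split=> [x y|s x|x|] /=.
- by rewrite qtraceD (trace_formD tauP).
- by rewrite qtraceZ (trace_formZ tauP).
- rewrite qtraceX ?(trace_form_frobenius tauP) //.
  rewrite (eq_pnat _ (fmorph_pchar (iota \o j : {rmorphism F -> L}))).
  exact: pchar_nat_card.
have [y tauy] := trace_form_nontrivial tauP; exists (iota (2^-1 * y)).
by rewrite qtrace_iota mulVKf.
Qed.

Section KloostermanQuadratic.

Variables (chi : K -> algC) (a b : K).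
Hypothesis chiC : add_char chi.
Hypotheses (a0 : a != 0) (b0 : b != 0).

(* The value of [chi (a x + b / x)] in terms of the trace and norm [w] of [x], and
   of [chi (a x + b / x) * chi (a y + b / y)] in terms of the sum and product [w]
   of [x] and [y]. *)
Let weight (w : K * K) : algC := chi ((a + b / w.2) * w.1).

Lemma kloosterman_qtrace_fibers :
  kloosterman (chi \o qtrace) (iota a) (iota b) =
  \sum_(w | w.2 != 0) #|[set x | (qtrace x, qnorm x) == w]|%:R * weight w.
Proof.
rewrite -(sum_fibers (fun w => w.2 != 0)); apply: eq_big => x.
  by rewrite /= qnorm_eq0.
by move=> x0; rewrite /weight /= qtraceD !qtraceZ qtraceV // mulrDl mulrA mulrAC.
Qed.

Lemma kloosterman_sqr_fibers :
  kloosterman chi a b ^+ 2 =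
  \sum_(w | w.2 != 0) #|[set z : K * K | (z.1 + z.2, z.1 * z.2) == w]|%:R * weight w.
Proof.
rewrite -(sum_fibers (fun w => w.2 != 0) (fun z : K * K => (z.1 + z.2, z.1 * z.2))).
rewrite expr2 mulr_suml; under eq_bigr do rewrite mulr_sumr.
rewrite pair_big /=; apply: eq_big => [z|z /andP[z1 z2]].
  by rewrite mulf_eq0 negb_or.
rewrite -add_charD // /weight /=; congr chi; field; exact/andP.
Qed.

Lemma sum_kloosterman_weight : \sum_(w | w.2 != 0) weight w = Q%:R.
Proof.
rewrite (eq_bigl (fun w : K * K => xpredT w.1 && (w.2 != 0))) //.
rewrite -(pair_big xpredT (fun n : K => n != 0) (fun t n => weight (t, n))) /=.
rewrite exchange_big /=.
under eq_bigr do rewrite /weight /= add_char_sumM //.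
have root0 : - b / a != 0 by rewrite mulf_neq0 ?oppr_eq0 ?invr_eq0.
rewrite (bigD1 (- b / a)) //= big1 ?addr0 => [|n /andP[n0 n_neq]].
  by rewrite invfM invrK invrN mulrA mulrN mulfV // mulN1r subrr eqxx mul1r.
suff -> : (a + b / n == 0) = false by rewrite mul0r.
apply: contraNF n_neq => /eqP n_root; apply/eqP.
have -> : - b / a = n - (a + b / n) * n / a by field; exact/andP.
by rewrite n_root !mul0r subr0.
Qed.

Lemma kloosterman_quadratic :
  kloosterman (chi \o qtrace) (iota a) (iota b) = 2 * Q%:R - kloosterman chi a b ^+ 2.
Proof.
apply/eqP; rewrite eq_sym subr_eq eq_sym; apply/eqP.
rewrite kloosterman_qtrace_fibers kloosterman_sqr_fibers -big_split /=.
rewrite -sum_kloosterman_weight mulr_sumr; apply: eq_bigr => w _.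
by rewrite -mulrDl -natrD card_trace_norm_fibers.
Qed.

End KloostermanQuadratic.

End QuadraticExtension.

Lemma sum_kloosterman_trace_form (F L : finFieldType) (iota : {rmorphism F -> L})
    (tau : L -> F) (psi : F -> algC) (a b : L) :
    trace_form iota tau -> add_char psi ->
  \sum_s kloosterman (psi \o tau) (iota s * a) (iota s * b) =
  (#|F| * #|[set x : L | (x != 0)%R && (tau (a * x + b / x) == 0)%R]|)%:R.
Proof.
move=> tauP psiC; rewrite exchange_big /=.
rewrite (eq_bigr (fun x => (tau (a * x + b / x) == 0)%:R * #|F|%:R)) => [|x x0].
  rewrite -mulr_suml mulrC natrM; congr (_ * _).
  rewrite -natr_sum -sum1_card; congr (_%:R).
  by rewrite -big_mkcondr /=; apply: eq_bigl => x; rewrite inE.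
rewrite -(add_char_sumM _ psiC); apply: eq_bigr => s _; congr psi.
by rewrite [RHS]mulrC -(trace_formZ tauP) mulrDr !mulrA.
Qed.

Lemma kloosterman00 (F : finFieldType) (psi : F -> algC) : add_char psi ->
  kloosterman psi 0 0 = #|F|%:R - 1.
Proof.
move=> psiC; rewrite /kloosterman (eq_bigr (fun _ => 1)) => [|x _].
  by rewrite sumr_const cardC1 -subn1 natrB // ltnW // finNzRing_gt1.
by rewrite !mul0r addr0 add_char0.
Qed.

Lemma quadratic_orbit_leq4 (R : archiNumFieldType) (y : nat -> R) (B : R) :
    (forall j, y j \is Num.real) -> (forall j, y j.+1 = (y j - 2) ^+ 2) ->
    (forall j, y j <= B) ->
  y 0%N <= 4.
Proof.
move=> y_real y_step y_ub; rewrite real_leNgt ?realn ?y_real //; apply/negP => y0_gt4.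
have gap_gt0 : 0 < y 0%N - 4 by rewrite subr_gt0.
have gap_step j : y j.+1 - 4 = y j * (y j - 4) by rewrite y_step; ring.
have growth j : 4 ^+ j * (y 0%N - 4) <= y j - 4.
  elim: j => [|j IH]; first by rewrite expr0 mul1r.
  have gap_ge0 : 0 <= y j - 4 by apply: le_trans IH; rewrite mulr_ge0 ?exprn_ge0 // ltW.
  rewrite gap_step exprS -mulrA; apply: ler_pM => //; last by rewrite -subr_ge0.
  by rewrite mulr_ge0 ?exprn_ge0 // ltW.
have B_ge0 : 0 <= B.
  by apply: le_trans (y_ub 0%N); apply: ltW; apply: le_lt_trans y0_gt4.
have := archi_boundP (divr_ge0 B_ge0 (ltW gap_gt0)); set n := Num.bound _.
rewrite ltr_pdivrMr // => B_lt; suff : B < B by rewrite ltxx.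
apply: (lt_le_trans B_lt); apply: (le_trans _ (y_ub n)).
apply: (@le_trans _ _ (4 ^+ n * (y 0%N - 4))).
  by rewrite ler_pM2r // -natrX ler_nat ltnW // ltn_expl.
by apply: (le_trans (growth n)); rewrite lerBlDr lerDl.
Qed.

(* The Kloosterman sum over the [j]-th step of a tower of quadratic extensions of a
   field of size [q], as a function of the sum [k] over that field. *)
Fixpoint kloosterman_iter (q : nat) (k : algC) (j : nat) : algC :=
  if j is i.+1 then 2 * (q ^ (2 ^ i))%:R - kloosterman_iter q k i ^+ 2 else k.

Lemma kloosterman_iter_real q k j :
  k \is Num.real -> kloosterman_iter q k j \is Num.real.
Proof.
by move=> k_real; elim: j => //= j IH; rewrite rpredB ?rpredM ?rpredX ?realn.
Qed.

Section Weil.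

Variables (F : finFieldType) (psi : F -> algC).
Hypothesis psiC : add_char psi.
Hypothesis odd_F : odd #|F|.
Let q := #|F|.
Let F2 : 2 != 0 :> F. Proof. exact: natr2_neq0_odd_card. Qed.
Let q_gt2 : (2 < q)%N. Proof. exact: odd_card_gt2. Qed.

Lemma kloosterman_tower j :
  exists (L : finFieldType) (iota : {rmorphism F -> L}) (tau : L -> F),
    [/\ #|L| = (q ^ (2 ^ j))%N, trace_form iota tau &
        forall a b : F, a != 0 -> b != 0 ->
          kloosterman (psi \o tau) (iota a) (iota b) =
          kloosterman_iter q (kloosterman psi a b) j].
Proof.
elim: j => [|j [K [iota [tau [card_K tauP tauK]]]]].
  exists F, (idfun : {rmorphism F -> F}), id; split=> //; split=> //.
    exact: expf_card.
  by exists 1; rewrite oner_eq0.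
have K2 : 2 != 0 :> K by rewrite -(rmorph_nat iota) fmorph_eq0.
have [L [kappa card_L]] := quadratic_extension_exists K2.
exists L, (kappa \o iota : {rmorphism F -> L}), (tau \o qtrace kappa); split.
- by rewrite card_L card_K -expnM -expnSr.
- exact: trace_form_qtrace.
move=> a b a0 b0 /=; rewrite -tauK // -card_K.
have tauC := trace_form_add_char tauP psiC.
by rewrite -(kloosterman_quadratic kappa card_L tauC) ?fmorph_eq0.
Qed.

Lemma kloosterman_iter_sum_ub a b j : a != 0 -> b != 0 ->
  \sum_(s | s != 0) - kloosterman_iter q (kloosterman psi (s * a) (s * b)) j.+1
  <= (7 * q ^ 2 * q ^ (2 ^ j))%:R.
Proof.
move=> a0 b0; have [L [iota [tau [card_L tauP tauK]]]] := kloosterman_tower j.+1.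
have r_qD : (q ^ (2 ^ j) = q * q ^ (2 ^ j).-1)%N by rewrite -expnS prednK // expn_gt0.
have card_L_qD : #|L| = ((q * q ^ (2 ^ j).-1) ^ 2)%N by rewrite -r_qD -expnM -expnSr.
have iota_a0 : iota a != 0 by rewrite fmorph_eq0.
have := card_trace_form_zeros_lb q_gt2 card_L_qD (iota b) iota_a0 tauP.
have := sum_kloosterman_trace_form (iota a) (iota b) tauP psiC.
rewrite -/q -r_qD; set N0 := [set x | _] => sum_eq card_leq.
rewrite (eq_bigr (fun s =>
  - kloosterman (psi \o tau) (iota s * iota a) (iota s * iota b))) => [|s s0]; last first.
  by rewrite -!rmorphM tauK ?mulf_neq0.
move: sum_eq; rewrite (bigD1 0) //= !rmorph0 !mul0r.
rewrite (kloosterman00 (trace_form_add_char tauP psiC)) sumrN.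
set S := \sum_(s | _) _; move/(canRL (addKr _)) => ->.
rewrite opprD opprK lerBlDr lerBlDr -natrD natr1 ler_nat addnC; exact: leqW.
Qed.

Lemma kloosterman_iter_sqr_ub a b j : a != 0 -> b != 0 ->
  kloosterman_iter q (kloosterman psi a b) j ^+ 2 <= (9 * q ^ 2 * q ^ (2 ^ j))%:R.
Proof.
move=> a0 b0; set r := (q ^ (2 ^ j))%N.
pose k s := kloosterman_iter q (kloosterman psi (s * a) (s * b)) j.
have k_sqr_ge0 s : 0 <= k s ^+ 2.
  by rewrite real_exprn_even_ge0 // kloosterman_iter_real // kloosterman_real.
apply: (@le_trans _ _ (\sum_(s | s != 0) k s ^+ 2)).
  by rewrite (bigD1 1) ?oner_eq0 //= {1}/k !mul1r lerDl sumr_ge0.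
have -> : \sum_(s | s != 0) k s ^+ 2 = \sum_(s | s != 0)
    - kloosterman_iter q (kloosterman psi (s * a) (s * b)) j.+1 +
    \sum_(s : F | s != 0) (2 * r)%:R.
  by rewrite -big_split /=; apply: eq_bigr => s _; rewrite opprB natrM -/r subrK.
apply: (le_trans (lerD (kloosterman_iter_sum_ub j a0 b0) (lexx _))).
rewrite sumr_const cardC1 -mulrnA -natrD ler_nat -/q -/r.
by move: q_gt2; case: (q) => [//|q'] _ /=; nia.
Qed.

Theorem kloosterman_weil a b : a != 0 -> b != 0 -> kloosterman psi a b ^+ 2 <= 4 * q%:R.
Proof.
move=> a0 b0; set K := kloosterman psi a b.
have r_gt0 j : 0 < (q ^ (2 ^ j))%:R :> algC.
  by rewrite ltr0n expn_gt0 (ltn_trans _ q_gt2).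
pose y j := kloosterman_iter q K j ^+ 2 / (q ^ (2 ^ j))%:R.
have y0E : y 0%N = K ^+ 2 / q%:R by rewrite /y /= expn0 expn1.
rewrite -ler_pdivrMr -?y0E; last by rewrite ltr0n (ltn_trans _ q_gt2).
apply: (@quadratic_orbit_leq4 _ y (9 * q ^ 2)%:R) => j.
- by rewrite rpredM ?rpredX ?rpredV ?realn ?kloosterman_iter_real ?kloosterman_real.
- rewrite /y /= expnSr expnM [((q ^ _) ^ 2)%:R]natrX.
  by move: (r_gt0 j); set r := (q ^ _)%:R => /lt0r_neq0 r0; field.
- by rewrite ler_pdivrMr // -natrM kloosterman_iter_sqr_ub.
Qed.

Lemma kloosterman_norm a b : a != 0 -> `|kloosterman psi a b| <= 2 * sqrtC q%:R.
Proof.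
move=> a0; have sqrt_ge1 : 1 <= sqrtC q%:R :> algC.
  by rewrite -[leLHS]sqrtC1 ler_sqrtC ?nnegrE ?ler01 ?ler0n // ler1n ltnW // ltnW.
have sqrt_ge0 : 0 <= sqrtC q%:R :> algC := le_trans ler01 sqrt_ge1.
have [->|b0] := eqVneq b 0.
  suff -> : kloosterman psi a 0 = -1.
    by rewrite normrN1 mulr_natl mulr2n (le_trans sqrt_ge1) // lerDl.
  have := add_char_sumM a psiC.
  rewrite (bigD1 0) //= (negPf a0) mul0r mulr0 (add_char0 psiC).
  move/eqP; rewrite addrC addr_eq0 => /eqP <-; rewrite /kloosterman.
  by apply: eq_bigr => s _; rewrite mul0r addr0.
rewrite -(@ler_pXn2r _ 2) ?nnegrE ?mulr_ge0 // exprMn sqrtCK.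
rewrite real_normK ?kloosterman_real // -natrX.
exact: kloosterman_weil.
Qed.

End Weil.

(** * Gauss and Salie sums *)

Section QuadraticCharacter.

Variable F : finFieldType.
Hypothesis F2 : 2 != 0 :> F.

Definition quad_char (s : F) : algC :=
  if s == 0 then 0 else if [exists c, c ^+ 2 == s] then 1 else -1.

Variant quad_char_spec (s : F) : algC -> Prop :=
| QuadCharZero of s = 0 : quad_char_spec s 0
| QuadCharSquare c of c != 0 & s = c ^+ 2 : quad_char_spec s 1
| QuadCharNonsquare of (forall c, c ^+ 2 != s) : quad_char_spec s (-1).

Lemma quad_charP s : quad_char_spec s (quad_char s).
Proof.
rewrite /quad_char; have [s0 | s0] := eqVneq s 0; first by constructor.
case: existsP => [[c /eqP cs]|s_nonsquare].
  by apply: (@QuadCharSquare _ c); rewrite // -sqrf_eq0 cs.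
by constructor=> c; apply/eqP => cs; case: s_nonsquare; exists c; rewrite cs.
Qed.

Lemma quad_char0 : quad_char 0 = 0. Proof. by rewrite /quad_char eqxx. Qed.

Lemma quad_char_sqr c : c != 0 -> quad_char (c ^+ 2) = 1.
Proof.
move=> c0; rewrite /quad_char sqrf_eq0 (negPf c0).
by case: existsP => // -[]; exists c.
Qed.

Lemma quad_charX2 s : s != 0 -> quad_char s ^+ 2 = 1.
Proof. by case: quad_charP => [->|c _ _|_]; rewrite ?eqxx ?sqrrN ?expr1n. Qed.

Lemma card_sqrt x : #|[set u : F | u ^+ 2 == x]|%:R = 1 + quad_char x.
Proof.
case: quad_charP => [->|c c0 ->|x_nonsquare].
- rewrite addr0 (_ : [set u | _] = [set 0]) ?cards1 //.
  by apply/setP => u; rewrite !inE sqrf_eq0.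
- rewrite (_ : [set u | _] = [set c; - c]); last by apply/setP => u; rewrite !inE eqf_sqr.
  rewrite cards2 (_ : c != - c) // -subr_eq0 opprK -mulr2n -mulr_natl.
  by rewrite mulf_neq0.
- rewrite subrr (_ : [set u | _] = set0) ?cards0 //.
  by apply/setP => u; rewrite !inE (negPf (x_nonsquare u)).
Qed.

Lemma card_mul_sqrt_leq2 (e x : F) : e != 0 ->
  (#|[set u | (e * u ^+ 2 == x)%R]| <= 2)%N.
Proof.
move=> e0; apply: leq_trans (card_quadratic_roots_leq2 0 (- x) e0).
apply: subset_leq_card; apply/subsetP => u; rewrite !inE => /eqP <-.
by rewrite mul0r addr0 subrr.
Qed.

Lemma card_sqrt_nonsquare (e x : F) : (forall c, c ^+ 2 != e) ->
  (#|[set u | (u ^+ 2 == x)%R]| + #|[set u | (e * u ^+ 2 == x)%R]| = 2)%N.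
Proof.
move=> e_nonsquare; have e0 : e != 0 by have := e_nonsquare 0; rewrite expr0n eq_sym.
apply: card_fibersD_eq x => [x|]; last by rewrite muln2 addnn.
have [->|x0] := eqVneq x 0.
  have card_fiber0 (f : F -> F) : (forall u, (f u == 0) = (u == 0)) ->
      #|[set u | f u == 0]| = 1%N.
    move=> f_eq0; rewrite -(cards1 (0 : F)); apply: eq_card => u.
    by rewrite !inE f_eq0.
  by rewrite !card_fiber0 // => u; rewrite ?sqrf_eq0 // mulf_eq0 (negPf e0) sqrf_eq0.
have [-> | [u]] := set_0Vmem [set u : F | u ^+ 2 == x].
  by rewrite cards0 card_mul_sqrt_leq2.
rewrite inE => /eqP ux; rewrite [X in (_ + X)%N](_ : _ = 0%N).
  rewrite addn0; have := card_mul_sqrt_leq2 x (oner_neq0 F).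
  by under eq_finset do rewrite mul1r.
apply/eqP; rewrite cards_eq0; apply/eqP/setP => v; rewrite !inE; apply/negP => /eqP vx.
have v0 : v != 0 by apply: contra_neq x0 => v0; rewrite -vx v0 expr0n mulr0.
by have /eqP := e_nonsquare (u / v); apply; rewrite exprMn ux -vx exprVn mulfK ?sqrf_eq0.
Qed.

End QuadraticCharacter.

Section GaussSalie.

Variables (F : finFieldType) (psi : F -> algC).
Implicit Types a b c e m s t v : F.
Hypothesis psiC : add_char psi.
Hypothesis F2 : 2 != 0 :> F.
Let q := #|F|.

Let F4 : 4 != 0 :> F. Proof. exact: natr4_neq0. Qed.

Definition gauss (s : F) : algC := \sum_u psi (s * u ^+ 2).

Lemma gauss_complete_square s m : s != 0 ->
  \sum_u psi (s * u ^+ 2 + m * u) = gauss s * psi (- m ^+ 2 / (4 * s)).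
Proof.
move=> s0; rewrite /gauss mulr_suml (reindex_inj (addIr (- (m / (2 * s))))) /=.
apply: eq_bigr => u _; rewrite -add_charD //; congr psi.
by field; rewrite s0 F2 F4.
Qed.

Lemma gauss_conj s : (gauss s)^* = gauss (- s).
Proof.
rewrite /gauss rmorph_sum; apply: eq_bigr => u _.
by rewrite /= add_char_conj // mulNr.
Qed.

Lemma gauss_mul_conj s : s != 0 -> gauss s * (gauss s)^* = q%:R.
Proof.
move=> s0; rewrite gauss_conj mulrC /gauss mulr_suml.
transitivity (\sum_u \sum_v psi (s * v ^+ 2 + (2 * s * v) * u)).
  apply: eq_bigr => u _; rewrite mulr_sumr (reindex_inj (addrI u)) /=.
  by apply: eq_bigr => v _; rewrite -add_charD //; congr psi; ring.
rewrite exchange_big /=.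
under eq_bigr => v _.
  under eq_bigr do rewrite add_charD //.
  rewrite -mulr_sumr add_char_sumM //.
  over.
rewrite (bigD1 0) //= big1 ?addr0 => [|v v0].
  by rewrite mulr0 eqxx expr0n /= mulr0 add_char0 // !mul1r.
by rewrite !mulf_eq0 (negPf F2) (negPf s0) (negPf v0) /= mul0r mulr0.
Qed.

Lemma gauss_norm s : s != 0 -> `|gauss s| = sqrtC q%:R.
Proof.
move=> s0; apply/eqP; rewrite -(@eqrXn2 _ 2) ?sqrtC_ge0 ?ler0n //.
by rewrite sqrtCK normCK gauss_mul_conj.
Qed.

Lemma gauss_neq0 s : s != 0 -> gauss s != 0.
Proof.
move=> s0; rewrite -normr_eq0 gauss_norm // sqrtC_eq0 pnatr_eq0 -lt0n.
exact: ltnW (finNzRing_gt1 F).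
Qed.

Lemma gaussMsqr s c : c != 0 -> gauss (c ^+ 2 * s) = gauss s.
Proof.
move=> c0; rewrite /gauss [RHS](reindex_inj (mulfI c0)) /=.
by apply: eq_bigr => u _; congr psi; ring.
Qed.

Lemma gaussM_nonsquare e s : (forall c, c ^+ 2 != e) -> s != 0 ->
  gauss (e * s) = - gauss s.
Proof.
move=> e_nonsquare s0; apply/eqP; rewrite -addr_eq0 addrC; apply/eqP.
have -> : gauss s = \sum_x #|[set u | u ^+ 2 == x]|%:R * psi (s * x).
  exact: (sum_fibers xpredT (fun u => u ^+ 2) (fun x => psi (s * x))).
have -> : gauss (e * s) = \sum_x #|[set u | e * u ^+ 2 == x]|%:R * psi (s * x).
  rewrite -(sum_fibers xpredT (fun u => e * u ^+ 2) (fun x => psi (s * x))).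
  by apply: eq_bigr => u _; congr psi; ring.
rewrite -big_split /= (eq_bigr (fun x => 2 * psi (s * x))) => [|x _].
  by rewrite -mulr_sumr add_char_sumM // (negPf s0) mul0r mulr0.
by rewrite -mulrDl -natrD card_sqrt_nonsquare.
Qed.

Lemma gaussM s t : s != 0 -> t != 0 -> gauss (s * t) = quad_char s * gauss t.
Proof.
move=> s0 t0; case: quad_charP s0 => [->|c c0 -> _|s_nonsquare _].
- by rewrite eqxx.
- by rewrite mul1r gaussMsqr.
- by rewrite mulN1r gaussM_nonsquare.
Qed.

Lemma gaussE s : s != 0 -> gauss s = quad_char s * gauss 1.
Proof. by move=> s0; rewrite -{1}[s]mulr1 gaussM ?oner_eq0. Qed.

(* The Gauss sum turns multiplicativity of the quadratic character into [gaussM]. *)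
Lemma quad_charM s t : quad_char (s * t) = quad_char s * quad_char t.
Proof.
have [->|s0] := eqVneq s 0; first by rewrite mul0r quad_char0 mul0r.
have [->|t0] := eqVneq t 0; first by rewrite mulr0 quad_char0 mulr0.
apply: (mulIf (gauss_neq0 (oner_neq0 F))).
by rewrite -mulrA -!gaussE ?gaussM ?mulf_neq0.
Qed.

Lemma quad_charV s : quad_char s^-1 = quad_char s.
Proof.
have [->|s0] := eqVneq s 0; first by rewrite invr0.
by rewrite -[LHS]mul1r -(quad_char_sqr s0) -quad_charM expr2 mulfK.
Qed.

Lemma sum_quad_char_psi a : a != 0 -> \sum_s quad_char s * psi (a * s) = gauss a.
Proof.
move=> a0; rewrite /gauss (sum_fibers xpredT (fun u => u ^+ 2) (fun x => psi (a * x))).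
rewrite [RHS](eq_bigr (fun x => psi (a * x) + quad_char x * psi (a * x))) => [|x _].
  by rewrite big_split /= add_char_sumM // (negPf a0) mul0r add0r.
by rewrite card_sqrt // mulrDl mul1r.
Qed.

(* [s + c^2 / s = v] says that [(2 s - v)^2 = (v + 2 c) (v - 2 c)]. *)
Lemma card_inversion_fiber c v : c != 0 ->
  #|[set s | (s != 0) && (s + c ^+ 2 / s == v)]|%:R =
  1 + quad_char ((v + 2 * c) * (v - 2 * c)).
Proof.
move=> c0; rewrite -card_sqrt //; congr (_%:R).
rewrite -[LHS](card_imset _ (inj_comp (addIr (- v)) (mulfI F2))).
apply: eq_card => w; rewrite !inE /=; apply/imsetP/eqP => [[s + ->]|w_sqr].
  by rewrite inE => /andP[s0 /eqP <-] /=; field.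
have sum_w : (v + w) / 2 * (v - (v + w) / 2) = c ^+ 2.
  have -> : (v + w) / 2 * (v - (v + w) / 2) = (v ^+ 2 - w ^+ 2) / 4.
    by field; rewrite F2 F4.
  by rewrite w_sqr; field.
have s0 : (v + w) / 2 != 0.
  by apply: contraNneq c0 => s0; rewrite -sqrf_eq0 -sum_w s0 mul0r.
exists ((v + w) / 2); last by rewrite /=; field.
by rewrite inE s0 -sum_w mulrAC mulfV // mul1r addrC subrK eqxx.
Qed.

Lemma quad_char_inversion_fiber c v s : s != 0 -> s + c ^+ 2 / s = v ->
  v + 2 * c != 0 -> quad_char s = quad_char (v + 2 * c).
Proof.
move=> s0 <- vc0; have sqr_sc : s + c ^+ 2 / s + 2 * c = (s + c) ^+ 2 / s by field.
have sc0 : s + c != 0.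
  by apply: contraNneq vc0 => sc0; rewrite sqr_sc sc0 expr0n mul0r.
by rewrite sqr_sc quad_charM quad_char_sqr // mul1r quad_charV.
Qed.

Lemma sum_quad_char_inversion_fiber c v : c != 0 ->
  \sum_(s | (s != 0) && (s + c ^+ 2 / s == v)) quad_char s =
  quad_char (v + 2 * c) + quad_char (v - 2 * c).
Proof.
have nondegenerate c' : c' != 0 -> v + 2 * c' != 0 ->
    \sum_(s | (s != 0) && (s + c' ^+ 2 / s == v)) quad_char s =
    quad_char (v + 2 * c') + quad_char (v - 2 * c').
  move=> c0 vc0; rewrite (eq_bigr (fun _ => quad_char (v + 2 * c'))); last first.
    by move=> s /andP[s0 /eqP sv]; apply: quad_char_inversion_fiber sv vc0.
  rewrite sumr_const -cardsE -[LHS]mulr_natl card_inversion_fiber // quad_charM.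
  by rewrite mulrDl mul1r mulrAC -expr2 quad_charX2 // mul1r.
move=> c0; have [vc0 | vc0] := eqVneq (v + 2 * c) 0; last exact: nondegenerate.
have vNc0 : v + 2 * - c != 0.
  have -> : v + 2 * - c = v + 2 * c - 4 * c by ring.
  by rewrite vc0 sub0r oppr_eq0 mulf_neq0.
have := nondegenerate (- c) _ vNc0; rewrite oppr_eq0 sqrrN mulrN opprK => -> //.
exact: addrC.
Qed.

Definition salie a b : algC := \sum_(s | s != 0) quad_char s * psi (a * s + b / s).

Lemma salie_sqr a c : a != 0 -> c != 0 ->
  salie a (a * c ^+ 2) = (psi (2 * a * c) + psi (- (2 * a * c))) * gauss a.
Proof.
move=> a0 c0; rewrite /salie.
rewrite (partition_big (fun s => s + c ^+ 2 / s) xpredT) //=.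
transitivity (\sum_v (quad_char (v + 2 * c) + quad_char (v - 2 * c)) * psi (a * v)).
  apply: eq_bigr => v _; rewrite -sum_quad_char_inversion_fiber // mulr_suml.
  apply: eq_bigr => s /andP[s0 /eqP <-]; congr (_ * psi _).
  by rewrite mulrDr mulrA.
have shift w : \sum_v quad_char (v + w) * psi (a * v) = psi (- (a * w)) * gauss a.
  rewrite -sum_quad_char_psi // (reindex_inj (addIr (- w))) mulr_sumr /=.
  apply: eq_bigr => v _; rewrite subrK mulrCA -add_charD //; congr (_ * psi _).
  by ring.
under eq_bigr do rewrite mulrDl.
rewrite big_split /= !shift -mulrDl addrC; congr ((psi _ + psi _) * _); ring.
Qed.

(* The substitution [s := b / (a s)] changes the sign of the sum. *)
Lemma salie_nonsquare a b : (forall c, c ^+ 2 != b / a) -> salie a b = 0.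
Proof.
move=> ba_nonsquare; have ba0 : b / a != 0.
  by have := ba_nonsquare 0; rewrite expr0n eq_sym.
have [b0 a0] : b != 0 /\ a != 0.
  by apply/andP; move: ba0; rewrite mulf_eq0 invr_eq0 negb_or.
have quad_ba : quad_char (b / a) = -1.
  case: quad_charP ba0 => [->|c _ /esym/eqP|//]; first by rewrite eqxx.
  by rewrite (negPf (ba_nonsquare c)).
suff salieN : salie a b = - salie a b.
  apply/eqP; move/eqP: salieN.
  by rewrite -addr_eq0 -mulr2n -mulr_natl mulf_eq0 pnatr_eq0.
have swapK s : s != 0 -> b / a / (b / a / s) = s.
  by move=> s0; field; rewrite a0 b0 s0.
rewrite {1}/salie.
rewrite (reindex_onto (fun s => b / a / s) (fun s => b / a / s)) => [|s]; last first.
  exact: swapK.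
rewrite /salie -sumrN; apply: eq_big => s /=.
  rewrite mulf_eq0 (negPf ba0) invr_eq0 /=; case: (eqVneq s 0) => //= s0.
  by rewrite swapK ?eqxx.
have [-> | s0 _] := eqVneq s 0; first by rewrite invr0 mulr0 eqxx.
rewrite quad_charM quad_ba quad_charV mulN1r mulNr; congr (- (_ * psi _)).
by field; rewrite a0 b0 s0.
Qed.

Lemma salie_norm a b : a != 0 -> `|salie a b| <= 2 * sqrtC q%:R.
Proof.
move=> a0; have sqrt_ge0 : 0 <= sqrtC (q%:R : algC) by rewrite sqrtC_ge0 ler0n.
have [-> | b0] := eqVneq b 0.
  have -> : salie a 0 = gauss a.
    rewrite -sum_quad_char_psi // [RHS](bigD1 0) //= quad_char0 mul0r add0r.
    by apply: eq_bigr => s _; rewrite mul0r addr0.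
  by rewrite gauss_norm // mulr_natl mulr2n lerDl.
have [c /eqP c_sqr | nonsquare] := pickP [pred c | c ^+ 2 == b / a]; last first.
  by rewrite salie_nonsquare ?normr0 ?mulr_ge0 // => c; apply/negbT/nonsquare.
have bE : b = a * c ^+ 2 by rewrite c_sqr mulrC divfK.
have c0 : c != 0 by apply: contraNneq b0 => c0; rewrite bE c0 expr0n mulr0.
rewrite bE salie_sqr // normrM gauss_norm // ler_wpM2r //.
by apply: (le_trans (ler_normD _ _)); rewrite !add_char_norm.
Qed.

End GaussSalie.

(** * Counting distances *)

Lemma sum_rV_prod (F : finType) (R : comNzRingType) (d : nat) (f : 'I_d -> F -> R) :
  \sum_(x : 'rV[F]_d) \prod_i f i (x 0 i) = \prod_i \sum_u f i u.
Proof.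
rewrite bigA_distr_bigA /= (reindex (fun g : {ffun 'I_d -> F} => \row_i g i)) /=.
  by apply: eq_bigr => g _; apply: eq_bigr => i _; rewrite mxE.
exists (fun x : 'rV[F]_d => [ffun i => x 0 i]) => [g _ | x _].
  by apply/ffunP => i; rewrite ffunE mxE.
by apply/rowP => i; rewrite mxE ffunE.
Qed.

Section IosevichRudnev.

Variables (F : finFieldType) (psi : F -> algC).
Hypothesis psiC : add_char psi.
Hypothesis odd_F : odd #|F|.
Let q := #|F|.
Variable d : nat.
Implicit Types (s t a b : F) (m z : 'rV[F]_d) (E : {set 'rV[F]_d}).

Let F2 : 2 != 0 :> F. Proof. exact: natr2_neq0_odd_card. Qed.
Let F4 : 4 != 0 :> F. Proof. exact: natr4_neq0. Qed.

Definition dot m z : F := \sum_i m 0 i * z 0 i.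

Lemma sum_psi_dot z : \sum_m psi (dot m z) = (z == 0)%:R * q%:R ^+ d.
Proof.
under eq_bigr do rewrite /dot add_char_bigsum //.
rewrite (sum_rV_prod (fun i u => psi (u * z 0 i))).
under eq_bigr => i _.
  under eq_bigr do rewrite mulrC.
  rewrite add_char_sumM //; over.
have [->|/rV0Pn [i zi]] := eqVneq z 0.
  under eq_bigr do rewrite mxE eqxx mul1r.
  by rewrite prodr_const card_ord mul1r.
by rewrite mul0r (bigD1 i) //= (negPf zi) !mul0r.
Qed.

Lemma sum_psi_dual_square s u : s != 0 ->
  \sum_v psi (- (4 * s)^-1 * v ^+ 2 + u * v) = (gauss psi s)^* * psi (s * u ^+ 2).
Proof.
move=> s0; have dual0 : - (4 * s)^-1 != 0 by rewrite oppr_eq0 invr_eq0 mulf_neq0.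
rewrite gauss_complete_square // gauss_conj //; congr (_ * psi _).
  rewrite -(gaussMsqr psi (- s) (c := (2 * s)^-1)) ?invr_eq0 ?mulf_neq0 //.
  by congr (gauss psi _); field; rewrite s0 F2 F4.
by field; rewrite oppr_eq0 oner_eq0 s0 F4.
Qed.

Lemma psi_sqnorm_fourier s z : s != 0 ->
  q%:R ^+ d * psi (s * sqnorm z) =
  gauss psi s ^+ d * \sum_m psi (- sqnorm m / (4 * s) + dot m z).
Proof.
move=> s0; have -> : \sum_m psi (- sqnorm m / (4 * s) + dot m z) =
    \prod_i \sum_v psi (- (4 * s)^-1 * v ^+ 2 + z 0 i * v).
  rewrite -sum_rV_prod; apply: eq_bigr => m _; rewrite -add_char_bigsum //; congr psi.
  rewrite /sqnorm /dot -sumrN mulr_suml -big_split /=.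
  by apply: eq_bigr => i _; rewrite mulNr [_ / _]mulrC -mulNr [z 0 i * _]mulrC.
under [in RHS]eq_bigr do rewrite sum_psi_dual_square //.
rewrite big_split /= prodr_const card_ord mulrA -exprMn gauss_mul_conj //.
by rewrite -add_char_bigsum // mulr_sumr.
Qed.

Definition twisted_kloosterman a b : algC :=
  \sum_(s | s != 0) quad_char s ^+ d * psi (a * s + b / s).

Lemma twisted_kloosterman_norm a b : a != 0 ->
  `|twisted_kloosterman a b| <= 2 * sqrtC q%:R.
Proof.
move=> a0; have quad_char_odd s : s != 0 -> quad_char s ^+ d = quad_char s ^+ odd d.
  move=> s0; rewrite -{1}(odd_double_half d) exprD -mul2n exprM.
  by rewrite quad_charX2 // expr1n mulr1.
have -> : twisted_kloosterman a b = if odd d then salie psi a b else kloosterman psi a b.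
  rewrite /twisted_kloosterman; case: ifP => odd_d; apply: eq_bigr => s s0.
    by rewrite quad_char_odd // odd_d expr1.
  by rewrite quad_char_odd // odd_d expr0 mul1r.
by case: ifP => _; [exact: salie_norm | exact: kloosterman_norm].
Qed.

Definition dist_pairs E t : {set 'rV[F]_d * 'rV[F]_d} :=
  [set z in setX E E | sqnorm (z.1 - z.2) == t].

Definition fourier_energy E m : algC :=
  \sum_(z in setX E E) psi (dot m (z.1 - z.2)).

Lemma fourier_energy_ge0 E m : 0 <= fourier_energy E m.
Proof.
pose e := \sum_(x in E) psi (dot m x).
suff -> : fourier_energy E m = e * e^* by rewrite mul_conjC_ge0.
rewrite /e rmorph_sum mulr_suml; under eq_bigr do rewrite mulr_sumr.
rewrite pair_big /=; apply: eq_big => [z|z _]; first by rewrite inE.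
rewrite /= add_char_conj // -add_charD //; congr psi.
by rewrite /dot -sumrB; apply: eq_bigr => i _; rewrite !mxE mulrBr.
Qed.

Lemma sum_fourier_energy E : \sum_m fourier_energy E m = q%:R ^+ d * #|E|%:R.
Proof.
rewrite exchange_big /=; under eq_bigr do rewrite sum_psi_dot subr_eq0.
rewrite -mulr_suml mulrC; congr (_ * _); rewrite -natr_sum; congr (_%:R).
rewrite -big_mkcondr /= -sum1_card.
rewrite (reindex_onto (fun x => (x, x)) fst) /=; last by case=> x y /= /andP[_ /eqP->].
by apply: eq_bigl => x; rewrite !inE !eqxx !andbT andbb.
Qed.

Lemma card_dist_pairs_expansion E t :
  q%:R * #|dist_pairs E t|%:R - #|E|%:R ^+ 2 =
  \sum_(s | s != 0) \sum_(z in setX E E) psi (s * (sqnorm (z.1 - z.2) - t)).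
Proof.
have term0 : \sum_(z in setX E E) psi (0 * (sqnorm (z.1 - z.2) - t)) = #|E|%:R ^+ 2.
  rewrite (eq_bigr (fun _ => 1)) => [|z _]; last by rewrite mul0r add_char0.
  by rewrite sumr_const cardsX natrM expr2.
apply/eqP; rewrite -term0 subr_eq addrC; apply/eqP.
transitivity (\sum_s \sum_(z in setX E E) psi (s * (sqnorm (z.1 - z.2) - t)));
  last by rewrite (bigD1 0).
rewrite exchange_big /= (eq_bigr (fun z : 'rV[F]_d * 'rV[F]_d =>
  (sqnorm (z.1 - z.2) == t)%:R * q%:R)) => [|z _]; last first.
  by under eq_bigr do rewrite mulrC; rewrite add_char_sumM // subr_eq0.
rewrite -mulr_suml mulrC; congr (_ * _); rewrite -natr_sum -sum1_card.
by congr (_%:R); rewrite -big_mkcondr /=; apply: eq_bigl => z; rewrite [LHS]inE.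
Qed.

Lemma card_dist_pairs_fourier E t :
  q%:R ^+ d * (q%:R * #|dist_pairs E t|%:R - #|E|%:R ^+ 2) =
  gauss psi 1 ^+ d *
    \sum_m fourier_energy E m * twisted_kloosterman (- t) (- sqnorm m / 4).
Proof.
rewrite card_dist_pairs_expansion.
transitivity (\sum_(s | s != 0) \sum_(z in setX E E) \sum_m
   gauss psi 1 ^+ d * (psi (dot m (z.1 - z.2)) *
     (quad_char s ^+ d * psi (- t * s + - sqnorm m / 4 / s)))).
  rewrite mulr_sumr; apply: eq_bigr => s s0; rewrite mulr_sumr; apply: eq_bigr => z _.
  rewrite mulrBr add_charD // mulrA psi_sqnorm_fourier // mulr_sumr mulr_suml.
  apply: eq_bigr => m _; rewrite add_charD // gaussE // exprMn.
  rewrite [psi (- t * s + _)]add_charD // [- t * s]mulNr [t * s]mulrC.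
  have -> : - sqnorm m / (4 * s) = - sqnorm m / 4 / s by rewrite invfM mulrA.
  ring.
rewrite exchange_big /=; under eq_bigr do rewrite exchange_big /=.
rewrite exchange_big mulr_sumr /=; apply: eq_bigr => m _.
rewrite /fourier_energy mulr_suml mulr_sumr; apply: eq_bigr => z _.
by rewrite -!mulr_sumr.
Qed.

Theorem iosevich_rudnev E t : t != 0 ->
  `|q%:R * #|dist_pairs E t|%:R - #|E|%:R ^+ 2| <=
    2 * sqrtC q%:R ^+ d.+1 * #|E|%:R :> algC.
Proof.
move=> t0; set h := sqrtC _.
have qd_gt0 : 0 < q%:R ^+ d :> algC.
  by rewrite exprn_gt0 // ltr0n ltnW // finNzRing_gt1.
have h_ge0 : 0 <= h by rewrite sqrtC_ge0 ler0n.
rewrite -(ler_pM2l qd_gt0) -{1}(gtr0_norm qd_gt0) -normrM card_dist_pairs_fourier.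
rewrite normrM normrX gauss_norm ?oner_eq0 // -/h.
have -> : q%:R ^+ d * (2 * h ^+ d.+1 * #|E|%:R) =
    h ^+ d * \sum_m fourier_energy E m * (2 * h).
  by rewrite -mulr_suml sum_fourier_energy exprS; ring.
rewrite ler_wpM2l ?exprn_ge0 //; apply: (le_trans (ler_norm_sum _ _ _)).
apply: ler_sum => m _; have energy_ge0 := fourier_energy_ge0 E m.
rewrite normrM ger0_norm // ler_wpM2l //.
by rewrite twisted_kloosterman_norm // oppr_eq0.
Qed.

End IosevichRudnev.

Lemma norm_natrB_leq (R : numDomainType) (x y c : nat) (h : R) :
    0 <= h -> h ^+ 2 = c%:R ->
  (`|x%:R - y%:R| <= h) = ((x%:Z - y%:Z) ^+ 2 <= c%:Z).
Proof.
move=> h_ge0 h_sqr; rewrite -(@ler_pXn2r _ 2) ?nnegrE // h_sqr.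
rewrite real_normK ?rpredB ?realn // -(ler_int R).
by rewrite rmorphXn rmorphB /= -!pmulrn.
Qed.

Corollary iosevich_rudnev_real (R : rcfType) (F : finFieldType) (d : nat)
    (E : {set 'rV[F]_d}) (t : F) : odd #|F| -> t != 0 ->
  `|(#|F| * #|dist_pairs E t|)%:R - (#|E| ^ 2)%:R| <=
    2 * Num.sqrt (#|F| ^ d.+1)%:R * #|E|%:R :> R.
Proof.
move=> odd_F t0; have [psi psiC] := add_char_exists F.
have sqr_bound (K : numDomainType) (h : K) : h ^+ 2 = (#|F| ^ d.+1)%:R ->
    (2 * h * #|E|%:R) ^+ 2 = (4 * #|F| ^ d.+1 * #|E| ^ 2)%:R.
  by move=> h_sqr; rewrite !exprMn h_sqr -!natrX -!natrM.
rewrite (norm_natrB_leq _ _ _ (sqr_bound _ _ (sqr_sqrtr _))) ?mulr_ge0 ?sqrtr_ge0 //.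
have h_sqr : (sqrtC #|F|%:R ^+ d.+1) ^+ 2 = (#|F| ^ d.+1)%:R :> algC.
  by rewrite exprAC sqrtCK -natrX.
rewrite -(norm_natrB_leq _ _ _ (sqr_bound _ _ h_sqr)); last first.
  by rewrite !mulr_ge0 ?exprn_ge0 ?sqrtC_ge0 ?ler0n.
rewrite natrM [in X in _ - X]natrX; exact: (iosevich_rudnev psiC odd_F).
Qed.

Section ZeroCoordinates.

Variables (F : finFieldType) (d : nat).
Let q := #|F|.
Implicit Types (A : {set 'I_d}) (z w : 'rV[F]_d) (t : F).

Lemma card_vanishing_leq A :
  (#|[set w : 'rV[F]_d | [forall i in A, w ord0 i == 0%R]]| <= q ^ (d - #|A|))%N.
Proof.
pose f w := [ffun i => w 0 i].
have f_inj : injective f.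
  by move=> w w' /ffunP ww'; apply/rowP => i; have := ww' i; rewrite !ffunE.
have -> : (d - #|A|)%N = #|~: A| by rewrite [RHS]cardsCs setCK card_ord.
rewrite -(card_imset _ f_inj) -(card_pffun_on (0 : F)).
apply: subset_leq_card; apply/subsetP => _ /imsetP[w wA ->].
apply/pffun_onP; split=> //; apply/subsetP => i; rewrite !inE ffunE.
by apply: contra => iA; move: wA; rewrite inE => /forall_inP/(_ i iA).
Qed.

Lemma nzeros_lt_dim z : sqnorm z != 0 -> (nzeros z < d)%N.
Proof.
apply: contraNltn; rewrite -{1}[d]card_ord -cardsT => all_zero.
have /eqP/setP zero_set : [set i | z 0 i == 0] == [set: 'I_d].
  by rewrite eqEcard subsetT.
rewrite /sqnorm big1 // => i _; have := zero_set i.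
by rewrite !inE => /eqP->; rewrite expr0n.
Qed.

(* Such a vector is determined up to sign by the coordinates other than a given
   nonzero one. *)
Lemma card_sphere_zero_set_leq A t : t != 0 ->
  (#|[set z : 'rV[F]_d | ([set i | z ord0 i == 0%R] == A) && (sqnorm z == t)]|
     <= 2 * q ^ (d - #|A|.+1))%N.
Proof.
move=> t0; set Z := [set z | _].
have [-> | [z0]] := set_0Vmem Z; first by rewrite cards0.
rewrite inE => /andP[/eqP z0A /eqP z0t].
have [i iA] : exists i, i \notin A.
  apply/existsP; apply: contraLR (@nzeros_lt_dim z0 _); last by rewrite z0t.
  rewrite negb_exists -leqNgt => /forallP A_full.
  rewrite /nzeros z0A -{1}[d]card_ord subset_leq_card //.
  by apply/subsetP => i _; rewrite -[_ \in _]negbK A_full.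
pose erase_i z := \row_j (if j == i then 0 else z 0 j).
pose B := [set w : 'rV[F]_d | [forall j in i |: A, w ord0 j == 0]].
have leB : (#|B| <= q ^ (d - #|A|.+1))%N.
  by have := card_vanishing_leq (i |: A); rewrite cardsU1 iA.
apply: (@leq_trans (2 * #|B|)); last by rewrite leq_mul2l leB orbT.
apply: (leq_card_fibers (f := erase_i)) => [z|w _].
  rewrite inE => /andP[/eqP zA _]; rewrite inE; apply/forall_inP => j.
  by rewrite !inE mxE; case: eqP => //= _; rewrite -zA inE.
have erase_eq z j : erase_i z = w -> j != i -> z 0 j = w 0 j.
  by move=> /rowP/(_ j); rewrite mxE => + /negPf ji; rewrite ji.
have := card_quadratic_roots_leq2 0 (\sum_(j | j != i) w 0 j ^+ 2 - t) (oner_neq0 F).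
apply: leq_trans.
rewrite -(card_in_imset (f := fun z : 'rV[F]_d => z 0 i)) => [|z z']; last first.
  rewrite !inE => /andP[_ /eqP zw] /andP[_ /eqP z'w] zz'.
  apply/rowP => j; have [->//|ji] := eqVneq j i.
  by rewrite (erase_eq _ _ zw) // (erase_eq _ _ z'w).
apply: subset_leq_card; apply/subsetP => _ /imsetP[z + ->].
rewrite !inE => /andP[/andP[_ /eqP <-] /eqP zw].
suff -> : sqnorm z = z 0 i ^+ 2 + \sum_(j | j != i) w 0 j ^+ 2 by apply/eqP; ring.
rewrite /sqnorm (bigD1 i) //=; congr (_ + _); apply: eq_bigr => j ji.
by rewrite (erase_eq _ _ zw).
Qed.

Lemma card_sphere_many_zeros_leq k t : t != 0 ->
  (q * #|[set z : 'rV[F]_d | (k <= nzeros z) && (sqnorm z == t)%R]|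
     <= 2 ^ d.+1 * q ^ (d - k))%N.
Proof.
move=> t0; set Z := [set z | _].
have [-> | [z0]] := set_0Vmem Z; first by rewrite cards0 muln0.
rewrite inE => /andP[k_leq /eqP z0t].
have kd : (k < d)%N by apply: leq_ltn_trans k_leq (nzeros_lt_dim _); rewrite z0t.
have : (#|Z| <= 2 * q ^ (d - k.+1) * #|[set: {set 'I_d}]|)%N.
  apply: (leq_card_fibers (f := fun z => [set i | z 0 i == 0])) => [z|A _].
    by rewrite inE.
  have [kA | Ak] := leqP k #|A|; last first.
    rewrite (_ : [set x in Z | _] = set0) ?cards0 //; apply/setP => z; rewrite !inE.
    by apply/negP => /andP[/andP[kz _] /eqP zA]; move: kz; rewrite /nzeros zA leqNgt Ak.
  apply: (@leq_trans (2 * q ^ (d - #|A|.+1))).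
    apply: leq_trans (card_sphere_zero_set_leq A t0).
    by apply: subset_leq_card; apply/subsetP => z; rewrite !inE => /andP[/andP[_ ->] ->].
  by rewrite leq_mul2l leq_exp2l ?finNzRing_gt1 // leq_sub2l // ltnS.
rewrite -powersetT card_powerset cardsT card_ord => leZ.
apply: (@leq_trans (q * (2 * q ^ (d - k.+1) * 2 ^ d))).
  by rewrite leq_mul2l leZ orbT.
rewrite -(subnSK kd) !expnS; apply: eq_leq; ring.
Qed.

Variable E : {set 'rV[F]_d}.

Lemma kdist0 k : (0 < #|E|)%N -> 0 \in kdist k E.
Proof.
case/card_gt0P => x xE; apply/imset2P; exists x x => //.
rewrite subrr /knorm /sqnorm; case: ifP => // _.
by rewrite big1 // => i _; rewrite mxE expr0n.
Qed.

Lemma card_dist_pairs_notin_kdist k t : (0 < k)%N -> t \notin kdist k E ->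
  (#|dist_pairs E t|
     <= #|E| * #|[set z : 'rV[F]_d | (k <= nzeros z) && (sqnorm z == t)%R]|)%N.
Proof.
move=> k_gt0 tk; rewrite -cardsX.
rewrite -(card_imset (dist_pairs E t) (f := fun xy => (xy.1, xy.1 - xy.2))); last first.
  by move=> [x y] [x' y'] /= [-> /addrI/oppr_inj->].
apply: subset_leq_card; apply/subsetP => _ /imsetP[[x y] + ->].
rewrite !inE /= => /andP[/andP[xE yE] xyt]; rewrite xE xyt andbT /= leqNgt.
apply: contra tk => few_zeros; apply/imset2P; exists x y => //.
by rewrite /knorm ifT ?(eqP xyt) // subn1 -ltnS prednK.
Qed.

Theorem card_notin_kdist_leq (R : rcfType) k t : odd q -> (0 < k)%N -> t != 0 ->
    t \notin kdist k E ->
  #|E|%:R <= 2 * Num.sqrt (q ^ d.+1)%:R + (2 ^ d.+1 * q ^ (d - k))%:R :> R.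
Proof.
move=> odd_q k_gt0 t0 tk.
have pairs_leq : (q * #|dist_pairs E t| <= #|E| * (2 ^ d.+1 * q ^ (d - k)))%N.
  have := card_sphere_many_zeros_leq k t0; set Z := [set z | _] => leZ.
  apply: (@leq_trans (q * (#|E| * #|Z|))).
    by rewrite leq_mul2l card_dist_pairs_notin_kdist ?orbT.
  by rewrite mulnCA leq_mul2l leZ orbT.
have [E0 | E_gt0] := posnP #|E|.
  by rewrite E0 addr_ge0 ?mulr_ge0 ?sqrtr_ge0 ?ler0n.
have := iosevich_rudnev_real R E odd_q t0; rewrite distrC => /ler_normlW.
rewrite lerBlDr => sqr_leq; rewrite -(@ler_pM2l _ #|E|%:R) ?ltr0n // mulrDr.
rewrite -!natrM mulnn; apply: (le_trans sqr_leq).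
by rewrite mulrC lerD2l ler_nat.
Qed.

End ZeroCoordinates.

Lemma sqrt_natX_powR (R : realType) (q n : nat) :
  Num.sqrt (q ^ n)%:R = powR q%:R (n%:R / 2) :> R.
Proof. by rewrite powRrM powR12_sqrt ?powR_ge0 // powR_mulrn ?ler0n // natrX. Qed.

Lemma kdist_error_leq (R : realType) (q d k : nat) : (0 < q)%N -> (k <= d)%N ->
  2 * Num.sqrt (q ^ d.+1)%:R + (2 ^ d.+1 * q ^ (d - k))%:R <=
  (2 + (2 ^ d.+1)%:R) * powR q%:R (Num.max ((d%:R + 1) / 2) (d%:R - k%:R)) :> R.
Proof.
move=> q_gt0 kd; set M := Num.max _ _.
have powR_leq a : a <= M -> powR q%:R a <= powR q%:R M.
  by apply: ler_powR; rewrite ler1n.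
rewrite [leRHS]mulrDl natrM lerD // ler_wpM2l ?ler0n //.
  by rewrite sqrt_natX_powR -natr1 powR_leq // le_max lexx.
by rewrite natrX -powR_mulrn ?ler0n // natrB // powR_leq // le_max lexx orbT.
Qed.

Theorem theorem1p4 (R : realType) (d k : nat)
    (hd : (2 <= d)%N) (hk : (1 <= k <= d)%N) :
  exists C : R, 0 < C /\
    forall (p n q : nat) (F : finFieldType),
      prime p -> odd p -> (0 < n)%N -> q = (p ^ n)%N -> #|F| = q ->
    forall E : {set 'rV[F]_d},
      C * powR q%:R (Num.max ((d%:R + 1) / 2) (d%:R - k%:R)) <= #|E|%:R ->
      kdist k E = [set: F].
Proof.
case/andP: hk => k_gt0 kd; pose B : R := 2 + (2 ^ d.+1)%:R.
have B_gt0 : 0 < B by rewrite addr_gt0 // ltr0n expn_gt0.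
exists (B + 1); split; first by rewrite addr_gt0.
move=> p n q F _ odd_p _ qE cardF E; set P := powR _ _ => E_large.
have odd_F : odd #|F| by rewrite cardF qE oddX odd_p orbT.
have q_gt0 : (0 < q)%N by rewrite -cardF ltnW // finNzRing_gt1.
have P_gt0 : 0 < P by rewrite powR_gt0 // ltr0n.
have E_gt0 : (0 < #|E|)%N.
  by rewrite -(ltr0n R) (lt_le_trans _ E_large) // mulr_gt0 // addr_gt0.
apply/setP => t; rewrite inE; apply: contraTT isT => t_notin.
have t0 : t != 0 by apply: contraNneq t_notin => ->; apply: kdist0.
have E_leq := card_notin_kdist_leq R odd_F k_gt0 t0 t_notin.
rewrite cardF in E_leq; have := le_trans E_leq (kdist_error_leq R q_gt0 kd).
by rewrite leNgt (lt_le_trans _ E_large) // [ltRHS]mulrDl mul1r ltrDl.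
Qed.
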